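(* For every $\varepsilon>0$ there is a constant $C_\varepsilon>0$ such that for all $m,n\in\mathbb{N}$ $$f_4(m,n)\le C_\varepsilon\, n^{\varepsilon}\min\left\{\frac{n^{3/2}}{m^{3/4}},\ \frac{n^{8/5}}{m}\right\}.$$
   Context: $\mathbb{N}$ denotes the positive integers. For $k,m,n\in\mathbb{N}$, $$f_k(m,n)=\left|\left\{(a_1,\ldots,a_k)\in\mathbb{N}^k:\ a_1\le\cdots\le a_k,\ \frac{m}{n}=\sum_{i=1}^k\frac1{a_i}\right\}\right|.$$ *)

(* Defs.v *)
From mathcomp Require Import all_boot all_order all_algebra.
From mathcomp Require Import finmap.
From mathcomp Require Import all_classical all_reals all_analysis.

Set Implicit Arguments.
Unset Strict Implicit.
Unset Printing Implicit Defensive.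

Import Order.TTheory GRing.Theory Num.Theory.

Local Open Scope classical_set_scope.
Local Open Scope ring_scope.

Definition egyptian (k : nat) (q : rat) : set (k.-tuple nat) :=
  [set a : k.-tuple nat | [/\ all (leq 1) a, sorted leq a &
                            q = \sum_(i < k) (tnth a i)%:R^-1]].

Arguments egyptian : clear implicits.

Lemma finite_egyptian (k : nat) (q : rat) : finite_set (egyptian k q).
Proof.
elim: k q => [|k IHk] q.
  by apply: (sub_finite_set (B := [set [tuple]])) => // a _ /=; rewrite tuple0.
have [q_le0|q_gt0] := leP q 0.
  apply: (sub_finite_set (B := set0)) => // a [/allP a_pos _ qE].
  move: q_le0; rewrite qE leNgt big_ord_recl ltr_pwDl ?sumr_ge0//.
  by rewrite invr_gt0 ltr0n; apply/a_pos/mem_tnth.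
pose B := Num.bound (k.+1%:R / q).
pose F (b : nat) := (fun t : k.-tuple nat => [tuple of b :: t]) @`
  egyptian k (q - b%:R^-1).
apply: (sub_finite_set (B := \bigcup_(b in `I_B) F b)); last first.
  by apply: bigcup_finite => // b _; apply/finite_image/IHk.
move=> a; case: (tupleP a) => b t [/= /andP[b_gt0 t_pos] bt_sorted qE].
exists b; last first.
  exists t => //; split=> //; first exact: path_sorted bt_sorted.
  rewrite qE big_ord_recl tnth0 addrC addKr.
  by apply: eq_bigr => i _; rewrite tnthS.
have b0 : 0 < b%:R :> rat by rewrite ltr0n.
have q_le : q <= k.+1%:R / b%:R.
  rewrite qE mulr_natl -[X in _ *+ X]card_ord -sumr_const ler_sum// => i _.
  have b_le : (b <= tnth [tuple of b :: t] i)%N.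
    have /allP b_min := order_path_min leq_trans bt_sorted.
    by have := mem_tnth i [tuple of b :: t]; rewrite inE => /predU1P[->//|/b_min].
  by rewrite lef_pV2 ?ler_nat// posrE ltr0n (leq_trans b_gt0).
rewrite /= -(ltr_nat rat).
apply: le_lt_trans (archi_boundP _); last by rewrite divr_ge0// ltW.
by rewrite ler_pdivlMr// mulrC -ler_pdivlMr.
Qed.

(* The cardinality is not a default value: the set is always finite, by
   [finite_egyptian]. *)
Definition egyptian_count (k m n : nat) : nat :=
  #|` fset_set (egyptian k (m%:R / n%:R))|.

(* Main.v *)
Require Import Defs.
From mathcomp Require Import all_boot all_order all_algebra.
From mathcomp Require Import finmap.
From mathcomp Require Import all_classical all_reals all_analysis.
From mathcomp Require Import zify ring lra.

(** Let [a <= b <= c <= d] be a solution and [y = m a - n > 0].  Call a positive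
    integer attached to a solution a determining parameter if at most
    n^(O(eps)) solutions share its value; proofs of this always go through
    chains of the form "this unknown divides a number that is already known".
    If determining parameters f_1, ..., f_r satisfy f_1 ... f_r <= X on every
    solution, then one of the f_i is at most X^(1/r), so there are at most
    r n^(O(eps)) X^(1/r) solutions: no dyadic decomposition is needed.

    Write 1/x + 1/y in lowest terms as num(x,y) / den(x,y), put
    gam(x,y) = gcd(x + y, x y), and let t(x) = x / gcd(x, n).

    If y >= m, take g = gcd(t(b), t(c)), w = gcd(t(a), g) and
    - f_1 = (a - floor(n/m)) (g/w), which yields a, gcd(b, c), hence everything;
    - f_2 = (t(b)/g) (t(c)/g) w, which yields b/c, num(b,c), gcd(den(b,c), a),
      hence everything;
    - f_3 = num(c,d) gam(a,b), which yields (m a - n) (m b - n), hence everything.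
    The size relations y b <= 3 n a and m a <= 4 n give
    f_1^2 f_2 f_3 m^5 <= 4608 n^6.

    If y < m then a is known, and b, c, d solve y/(n a) = 1/b + 1/c + 1/d.  With
    q = n a, t taken relative to q, and g = gcd(t(c), t(d)), the parameters
    num(b,c), num(c,d), gcd(t(b), t(c)) and (t(c)/g) (t(d)/g) are determining,
    and num(b,c) num(c,d) gcd(t(b), t(c))^2 (t(c)/g) (t(d)/g) <= 36 q^3. *)

Set Implicit Arguments.
Unset Strict Implicit.
Unset Printing Implicit Defensive.

Import Order.TTheory GRing.Theory Num.Theory.

(** * The divisor bound *)

(** With u = floor(e/k), e + 1 <= k (u + 1) <= k 2^u, and the k-th power of k 2^u is at most k^k 2^e
    because k u <= e. *)
Lemma leq_expS_exp2 k e : 0 < k -> e.+1 ^ k <= k ^ k * 2 ^ e.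
Proof.
move=> k_gt0.
have e_le : e.+1 <= k * 2 ^ (e %/ k).
  have /leq_trans : e.+1 <= k * (e %/ k).+1.
    by rewrite {1}(divn_eq e k) mulnS addnC mulnC -addSn leq_add2r ltn_pmod.
  by apply; rewrite leq_mul2l ltn_expl ?orbT.
apply: leq_trans (_ : (k * 2 ^ (e %/ k)) ^ k <= _); first by rewrite leq_exp2r.
by rewrite expnMn -expnM leq_mul2l leq_exp2l ?leq_divM ?orbT.
Qed.

(** A divisor d of a b is gcd(d, a) times d / gcd(d, a), and this cofactor divides b because it is
    coprime to a / gcd(d, a). *)
Lemma size_divisorsM a b : 0 < a -> 0 < b ->
  size (divisors (a * b)) <= size (divisors a) * size (divisors b).
Proof.
move=> a_gt0 b_gt0; rewrite -(size_allpairs muln); apply: uniq_leq_size.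
  exact: divisors_uniq.
move=> d; rewrite -dvdn_divisors ?muln_gt0 ?a_gt0// => d_dvd.
apply/allpairsP; exists (gcdn d a, d %/ gcdn d a) => /=.
have d_gt0 : 0 < d by apply: dvdn_gt0 d_dvd; rewrite muln_gt0 a_gt0.
have g_gt0 : 0 < gcdn d a by rewrite gcdn_gt0 d_gt0.
split; rewrite -?dvdn_divisors ?dvdn_gcdr//; last first.
  by rewrite mulnC divnK// dvdn_gcdl.
have co : coprime (d %/ gcdn d a) (a %/ gcdn d a).
  by rewrite /coprime -(eqn_pmul2r g_gt0) muln_gcdl !divnK ?dvdn_gcdl ?dvdn_gcdr// mul1n.
rewrite -(Gauss_dvdr _ co) -(dvdn_pmul2r g_gt0) mulnAC !divnK ?dvdn_gcdl ?dvdn_gcdr//.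
Qed.

Lemma size_divisors_pexp p e : prime p -> size (divisors (p ^ e)) = e.+1.
Proof.
move=> p_pr.
have -> : e.+1 = size [seq p ^ i | i <- iota 0 e.+1] by rewrite size_map size_iota.
apply/perm_size/uniq_perm; first exact: divisors_uniq.
  rewrite map_inj_in_uniq ?iota_uniq// => i j _ _ /eqP.
  by rewrite eqn_exp2l ?prime_gt1// => /eqP.
move=> d; rewrite -dvdn_divisors ?expn_gt0 ?prime_gt0//.
apply/(dvdn_pfactor _ _ p_pr)/mapP => -[i].
  by move=> ? ->; exists i; rewrite // mem_iota.
by rewrite mem_iota /= add0n ltnS => ? ->; exists i.
Qed.

(* A prime power p ^ e exactly dividing n contributes (e + 1) ^ k <= p ^ e if
   p >= 2 ^ k; each of the fewer than 2 ^ k smaller primes costs a factor k ^ k. *)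
Lemma size_divisors_exp_bound k : 0 < k ->
  exists2 C, 0 < C & forall n, 0 < n -> size (divisors n) ^ k <= C * n.
Proof.
move=> k_gt0; pose N := 2 ^ k.
(* Induction on a strict upper bound b for the prime factors of n. The exponent [minn b N] bounds
   the number of primes below both b and N, the ones that cost k ^ k. *)
suff main b n : 0 < n -> (forall p, p \in primes n -> p < b) ->
    size (divisors n) ^ k <= (k ^ k) ^ minn b N * n.
  exists ((k ^ k) ^ N); first by rewrite !expn_gt0 k_gt0.
  move=> n n_gt0.
  have := main n.+1 n n_gt0 _; move/(_ _)/leq_trans; apply.
    by move=> p; rewrite mem_primes => /and3P[_ _ /dvdn_leq]; apply.
  rewrite leq_pmul2r//; apply: leq_pexp2l; last exact: geq_minr.
  by rewrite expn_gt0 k_gt0.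
elim: b n => [|b IHb] n n_gt0 n_lt.
  have -> : n = 1.
    apply/eqP; rewrite eqn_leq n_gt0 andbT leqNgt; apply/negP => n_gt1.
    by have := n_lt (pdiv n); rewrite mem_primes pdiv_prime// n_gt0 pdiv_dvd => /(_ isT).
  by rewrite muln1 min0n exp1n.
have [b_pr|b_npr] := boolP (prime b); last first.
  apply: leq_trans (IHb n n_gt0 _) _.
    move=> p p_n; have := n_lt _ p_n; rewrite ltnS leq_eqVlt => /predU1P[pb|//].
    by move: p_n b_npr; rewrite mem_primes pb => /andP[->].
  rewrite leq_pmul2r//; apply: leq_pexp2l; first by rewrite expn_gt0 k_gt0.
  lia.
have [n' b_n' nE] := pfactor_coprime b_pr n_gt0.
move: (logn b n) nE => f nE.
have n'_gt0 : 0 < n' by move: n_gt0; rewrite nE muln_gt0 => /andP[].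
have be_gt0 : 0 < b ^ f by rewrite expn_gt0 prime_gt0.
have IH : size (divisors n') ^ k <= (k ^ k) ^ minn b N * n'.
  apply: IHb => // p; rewrite mem_primes => /and3P[p_pr _ p_n'].
  have : p \in primes n by rewrite mem_primes p_pr n_gt0 nE dvdn_mulr.
  move=> /n_lt; rewrite ltnS leq_eqVlt => /predU1P[pb|//].
  by move: b_n'; rewrite prime_coprime// -pb p_n'.
have tau_le : size (divisors n) ^ k <= size (divisors n') ^ k * f.+1 ^ k.
  by rewrite -expnMn leq_exp2r// -(size_divisors_pexp f b_pr) nE size_divisorsM.
apply: (leq_trans tau_le); rewrite nE.
have [b_lt|b_ge] := ltnP b N.
  have -> : minn b.+1 N = (minn b N).+1 by lia.
  rewrite expnS [k ^ k * _]mulnC -mulnA [k ^ k * _]mulnCA mulnA leq_mul//.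
  apply: leq_trans (leq_expS_exp2 f k_gt0) _.
  rewrite leq_mul2l; apply/orP; right.
  by case: f {nE be_gt0 tau_le} => // f; rewrite leq_exp2r ?prime_gt1.
have -> : minn b.+1 N = minn b N by lia.
rewrite mulnA leq_mul//.
apply: leq_trans (_ : N ^ f <= _); last first.
  by case: f {nE be_gt0 tau_le} => // f; rewrite leq_exp2r.
by rewrite -expnM mulnC expnM leq_exp2r// ltn_expl.
Qed.

(** * Sets of bounded size *)

(** Y is the integer part of the k-th root of X / c. Its maximality later refutes, at Y + 1, that
    all determining parameters exceed Y. *)
Lemma exists_root k c X : 0 < k -> 0 < c ->
  exists2 Y, Y ^ k * c <= X & forall z, z ^ k * c <= X -> z <= Y.
Proof.
move=> k_gt0 c_gt0.
have P0 : exists z, z ^ k * c <= X by exists 0; rewrite exp0n.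
have P_le z : z ^ k * c <= X -> z <= X.
  move=> zX; apply: leq_trans (_ : z <= z ^ k) _.
    by case: k k_gt0 {P0 zX} => // k _; rewrite expnS; case: z => // z; rewrite leq_pmulr ?expn_gt0.
  by apply: leq_trans zX; rewrite leq_pmulr.
by case: (ex_maxnP P0 P_le) => Y YX Y_max; exists Y.
Qed.

(** Duplicate-free lists express a cardinality bound for a [Prop]-valued predicate before anything
    is known about its finiteness. *)
Definition at_most (S : eqType) (K : nat) (P : S -> Prop) : Prop :=
  forall G : seq S, uniq G -> (forall s, s \in G -> P s) -> size G <= K.

Section AtMost.
Variable S : eqType.
Implicit Types (P Q : S -> Prop) (g : S -> nat) (K L : nat).

Lemma sub_at_most K P Q : (forall s, P s -> Q s) -> at_most K Q -> at_most K P.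
Proof. by move=> PQ KQ G G_uniq GP; apply: KQ => // s /GP/PQ. Qed.

Lemma at_most_unique P : (forall s s', P s -> P s' -> s = s') -> at_most 1 P.
Proof.
move=> P_inj [|s [|s' G]] //= /andP[+ _] GP.
have <- : s = s' by apply: P_inj; apply: GP; rewrite !inE eqxx ?orbT.
by rewrite mem_head.
Qed.

Lemma at_mostU K L P Q1 Q2 : (forall s, P s -> Q1 s \/ Q2 s) ->
  at_most K (fun s => P s /\ Q1 s) -> at_most L (fun s => P s /\ Q2 s) ->
  at_most (K + L) P.
Proof.
move=> PQ K1 L2 G G_uniq GP; rewrite -(count_predC (fun s => `[< Q1 s >]) G).
rewrite -!size_filter leq_add ?K1 ?L2 ?filter_uniq// => s.
  by rewrite mem_filter => /andP[/asboolP ? /GP].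
by rewrite mem_filter /= => /andP[/asboolP ? /GP Ps]; case: (PQ s Ps).
Qed.

Lemma at_most_image K P g (l : seq nat) : (forall s, P s -> g s \in l) ->
  (forall x, at_most K (fun s => P s /\ g s = x)) -> at_most (size l * K) P.
Proof.
elim: l P => [|x l IHl] P gl gK.
  by case=> // s G _ GP; have := gl s (GP s (mem_head _ _)).
rewrite /= mulSn; apply: (@at_mostU _ _ _ (fun s => g s = x) (fun s => g s \in l)).
- by move=> s /gl; rewrite inE => /predU1P.
- exact: gK.
- by apply: IHl => [s []|y] //; apply: sub_at_most (gK y) => s [[]].
Qed.

Lemma at_most_leq K P g X : (forall s, P s -> 0 < g s <= X) ->
  (forall x, at_most K (fun s => P s /\ g s = x)) -> at_most (X * K) P.
Proof.
move=> gX gK; rewrite -(size_iota 1 X); apply: at_most_image gK => s /gX.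
by rewrite mem_iota add1n ltnS.
Qed.

Lemma leq_at_most K L P : K <= L -> at_most K P -> at_most L P.
Proof. by move=> KL PK G G_uniq GP; apply: leq_trans KL; apply: PK. Qed.

End AtMost.

(** * Enumerating unknowns through the divisors of known numbers *)

Section Determination.
Variables (S : eqType) (M D : nat).
Hypothesis tau_le : forall W, 0 < W <= M -> size (divisors W) <= D.
Implicit Types (P : S -> Prop) (K : nat).

(** W is the same for all solutions counted: in applications, P already prescribes the parameters
    from which W is built. Each use costs one factor D. *)
Lemma at_most_dvd K P (g : S -> nat) W :
  (forall s, P s -> [/\ g s %| W, 0 < W & W <= M]) ->
  (forall x, at_most K (fun s => P s /\ g s = x)) -> at_most (D * K) P.
Proof.
move=> gW gK [//|s0 G] G_uniq GP.
have [_ W_gt0 W_le] := gW s0 (GP s0 (mem_head _ _)).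
apply: leq_trans (_ : size (divisors W) * K <= _).
  apply: (at_most_image (P := P) (g := g)) => // s /gW[? _ _].
  by rewrite -dvdn_divisors.
by rewrite leq_mul2r tau_le ?orbT// W_gt0.
Qed.

(** The equation R/E = 1/a + 1/b amounts to (R a - E)(R b - E) = E^2, so R a - E runs over divisors
    of E^2, and it fixes both a and b. *)
Lemma at_most_two_fractions K P (a b : S -> nat) R E :
  (forall s, P s -> [/\ 0 < a s, 0 < b s, R * a s * b s = E * (a s + b s),
                      0 < E & E ^ 2 <= M]) ->
  (forall x y, at_most K (fun s => [/\ P s, a s = x & b s = y])) ->
  at_most (D * K) P.
Proof.
move=> Pab abK; pose g s := R * a s - E.
have gE s : P s -> R * a s = g s + E /\ g s * b s = E * a s.
  move=> /Pab[a_gt0 b_gt0 eq_ab E_gt0 _].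
  have Ra : E < R * a s.
    rewrite -(ltn_pmul2r b_gt0) eq_ab ltn_pmul2l//.
    by rewrite -[X in X < _]add0n ltn_add2r.
  split; first by rewrite subnK// ltnW.
  by rewrite mulnBl eq_ab mulnDr addnK.
apply: (at_most_dvd (g := g) (W := E ^ 2)).
  move=> s Ps; have [a_gt0 b_gt0 eq_ab E_gt0 EM] := Pab s Ps.
  have [Ra gb] := gE s Ps; split; rewrite ?expn_gt0 ?E_gt0//.
  apply/dvdnP; exists (R * b s - E).
  suff : R * (g s * b s) = E * (g s + E).
    rewrite mulnBl; nia.
  by rewrite gb -Ra; lia.
move=> d.
apply: sub_at_most (abK ((d + E) %/ R) (E * ((d + E) %/ R) %/ d)) => s [Ps gd].
have [a_gt0 b_gt0 _ E_gt0 _] := Pab s Ps; have [Ra gb] := gE s Ps.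
have R_gt0 : 0 < R by rewrite lt0n; apply/eqP => R0; move: Ra; rewrite R0; lia.
have d_gt0 : 0 < d by rewrite -gd lt0n; apply/eqP => g0; move: gb; rewrite g0; nia.
have aE : (d + E) %/ R = a s by rewrite -gd -Ra mulKn.
by split; rewrite // aE// -gb gd mulKn.
Qed.

(** d divides A d as well as A X, hence also their gcd. *)
Lemma dvdn_gcd_factor d A X : d %| A * X -> d %| A * gcdn d X.
Proof. by move=> dAX; rewrite muln_gcdr dvdn_gcd dvdn_mull. Qed.

(* Write E = e X and a = e Y with X, Y coprime and d = p e X Y - q (R Y + X).
   Then b d = q e X Y, and since gcd(d, X) | q R and gcd(d, Y) | q, the number d
   divides q^3 R e.  Moreover (p e X - q R) (p e Y - q) = p e d + q^2 R. *)
Lemma at_most_three_fractions K P (E a b : S -> nat) R p q e :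
  (forall s, P s -> [/\ 0 < E s, 0 < a s & 0 < b s]) ->
  (forall s, P s -> gcdn (E s) (a s) = e) ->
  (forall s, P s ->
    p * E s * a s * b s = q * (R * a s * b s + E s * b s + E s * a s)) ->
  (forall s, P s -> [/\ 0 < q, 0 < R, q ^ 3 * R * e <= M &
                      p * e * (q ^ 3 * R * e) + q ^ 2 * R <= M]) ->
  (forall x y z, at_most K (fun s => [/\ P s, E s = x, a s = y & b s = z])) ->
  at_most (D * (D * K)) P.
Proof.
move=> P_gt0 Pe Peq PM EabK.
pose X s := E s %/ e; pose Y s := a s %/ e.
have e_gt0 s : P s -> 0 < e.
  by move=> Ps; rewrite -(Pe s Ps) gcdn_gt0; have [-> _ _] := P_gt0 s Ps.
have XE s : P s -> E s = e * X s.
  by move=> Ps; rewrite /X mulnC divnK// -(Pe s Ps) dvdn_gcdl.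
have YE s : P s -> a s = e * Y s.
  by move=> Ps; rewrite /Y mulnC divnK// -(Pe s Ps) dvdn_gcdr.
have XY s : P s -> coprime (X s) (Y s).
  move=> Ps; rewrite /coprime -(eqn_pmul2l (e_gt0 _ Ps)) muln_gcdr -XE// -YE//.
  by rewrite Pe// muln1.
have XY_gt0 s : P s -> 0 < X s /\ 0 < Y s.
  move=> Ps; have [] := P_gt0 s Ps; rewrite XE// YE// !muln_gt0.
  by move=> /andP[_ ->] /andP[_ ->].
pose d s := p * e * X s * Y s - q * (R * Y s + X s).
have eq_b s : P s ->
    p * e * X s * Y s * b s = q * (R * Y s + X s) * b s + q * e * X s * Y s.
  move=> Ps; apply/eqP; rewrite -(eqn_pmul2l (e_gt0 _ Ps)); apply/eqP.
  have := Peq s Ps; rewrite XE// YE//; lia.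
have d_gt s : P s -> q * (R * Y s + X s) < p * e * X s * Y s.
  move=> Ps; have [_ _ b_gt0] := P_gt0 s Ps; have [X_gt0 Y_gt0] := XY_gt0 s Ps.
  have [q_gt0 _ _ _] := PM s Ps; rewrite -(ltn_pmul2r b_gt0) eq_b//.
  by rewrite -[X in X < _]addn0 ltn_add2l !muln_gt0 q_gt0 X_gt0 Y_gt0 (e_gt0 _ Ps).
have dE s : P s -> p * e * X s * Y s = d s + q * (R * Y s + X s).
  by move=> Ps; rewrite /d subnK// ltnW// d_gt.
have db s : P s -> d s * b s = q * e * X s * Y s.
  by move=> Ps; have := eq_b s Ps; rewrite dE//; lia.
have d_dvd s : P s -> d s %| q ^ 3 * R * e.
  move=> Ps; have := dvdn_mulr (b s) (dvdnn (d s)); rewrite db// => /dvdn_gcd_factor.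
  rewrite mulnAC => /dvdn_gcd_factor/dvdn_trans; apply.
  (* Modulo gcd(d, X) the identity [dE] leaves only q R Y, and Y is coprime to X. The gcd with Y is
     treated in the same way. *)
  have gX : gcdn (d s) (X s) %| q * R.
    have cop : coprime (gcdn (d s) (X s)) (Y s).
      by apply: coprime_dvdl (XY _ Ps); rewrite dvdn_gcdr.
    rewrite -(Gauss_dvdl _ cop) -(dvdn_addl _ (n := q * X s)); last first.
      by rewrite dvdn_mull// dvdn_gcdr.
    rewrite -mulnA -mulnDr -(dvdn_addr _ (dvdn_gcdl (d s) (X s))) -dE//.
    by rewrite mulnAC dvdn_mull// dvdn_gcdr.
  have gY : gcdn (d s) (Y s) %| q.
    have cop : coprime (gcdn (d s) (Y s)) (X s).
      by rewrite coprime_sym; apply: coprime_dvdr (XY _ Ps); rewrite dvdn_gcdr.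
    rewrite -(Gauss_dvdl _ cop) -(dvdn_addr (m := q * R * Y s)); last first.
      by rewrite dvdn_mull// dvdn_gcdr.
    rewrite -mulnA -mulnDr -(dvdn_addr _ (dvdn_gcdl (d s) (Y s))) -dE//.
    by rewrite dvdn_mull// dvdn_gcdr.
  have -> : q ^ 3 * R * e = q * e * q * (q * R) by lia.
  by rewrite !dvdn_mul.
apply: (at_most_dvd (g := d) (W := q ^ 3 * R * e)).
  move=> s Ps; have [q_gt0 R_gt0 ? _] := PM s Ps; split; rewrite ?d_dvd//.
  by rewrite !muln_gt0 ?expn_gt0 q_gt0 R_gt0 (e_gt0 _ Ps).
move=> d0; pose h s := p * e * X s - q * R.
have hE s : P s -> p * e * X s = h s + q * R.
  move=> Ps; rewrite /h subnK//; have [_ Y_gt0] := XY_gt0 s Ps.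
  rewrite -(leq_pmul2r Y_gt0); apply: leq_trans (ltnW (d_gt s Ps)).
  by rewrite mulnDr mulnA leq_addr.
have hW s : P s -> h s * (p * e * Y s - q) = p * e * d s + q ^ 2 * R.
  move=> Ps; have := dE s Ps; have := hE s Ps; move: (h s) (d s) => hs ds.
  rewrite mulnBr; nia.
apply: (at_most_dvd (g := h) (W := p * e * d0 + q ^ 2 * R)) => [s [Ps <-]|h0].
  have [q_gt0 R_gt0 le1 le2] := PM s Ps; split.
  - by rewrite -hW// dvdn_mulr.
  - by rewrite addn_gt0 !muln_gt0 q_gt0 R_gt0 orbT.
  - apply: leq_trans le2; rewrite leq_add2r leq_mul2l dvdn_leq ?orbT ?d_dvd//.
    by rewrite !muln_gt0 q_gt0 R_gt0 (e_gt0 _ Ps).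
(* X is recovered from h, Y from the complementary factor p e Y - q, and b from b d = q e X Y. *)
pose X0 := (h0 + q * R) %/ (p * e).
pose Y0 := ((p * e * d0 + q ^ 2 * R) %/ h0 + q) %/ (p * e).
apply: sub_at_most (EabK (e * X0) (e * Y0) (q * e * X0 * Y0 %/ d0)) => s [[Ps ds] hs].
have [X_gt0 Y_gt0] := XY_gt0 s Ps; have [q_gt0 R_gt0 _ _] := PM s Ps.
have dlt := d_gt s Ps.
have pe_gt0 : 0 < p * e by case: (p * e) dlt.
have qlt : q < p * e * Y s.
  rewrite -(ltn_pmul2r X_gt0) mulnAC; apply: leq_ltn_trans dlt.
  by rewrite mulnDr leq_addl.
have h_gt0 : 0 < h s.
  have := hE s Ps; case: (h s) => // hs0.
  by move: dlt; rewrite hs0; nia.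
have d_gt0 : 0 < d s by rewrite subn_gt0.
have XX : X0 = X s by rewrite /X0 -hs -hE// mulKn.
have YY : Y0 = Y s by rewrite /Y0 -ds -hW// -hs mulKn// subnK ?mulKn// ltnW.
by split; rewrite ?XX ?YY -?XE -?YE -?db -?ds ?mulKn.
Qed.

End Determination.

(** * Sums of two unit fractions *)

(** These three functions are gam, num and den of the overview. *)
Definition gcd_add_mul (a b : nat) := gcdn (a + b) (a * b).
Definition sum_num (a b : nat) := (a + b) %/ gcd_add_mul a b.
Definition sum_den (a b : nat) := (a * b) %/ gcd_add_mul a b.

Section SumFractions.
Implicit Types a b : nat.

Lemma sum_numK a b : sum_num a b * gcd_add_mul a b = a + b.
Proof. by rewrite divnK ?dvdn_gcdl. Qed.

Lemma sum_denK a b : sum_den a b * gcd_add_mul a b = a * b.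
Proof. by rewrite divnK ?dvdn_gcdr. Qed.

Lemma gcd_add_mul_gt0 a b : 0 < a -> 0 < gcd_add_mul a b.
Proof. by move=> a_gt0; rewrite gcdn_gt0 addn_gt0 a_gt0. Qed.

Lemma sum_num_gt0 a b : 0 < a -> 0 < sum_num a b.
Proof.
move=> a_gt0; have := sum_numK a b; case: (sum_num a b) => // /esym/eqP.
by rewrite addn_eq0; lia.
Qed.

Lemma sum_den_gt0 a b : 0 < a -> 0 < b -> 0 < sum_den a b.
Proof.
move=> a_gt0 b_gt0; have := sum_denK a b; case: (sum_den a b) => // /esym/eqP.
by rewrite muln_eq0; lia.
Qed.

Lemma coprime_sum_num_den a b : 0 < a -> coprime (sum_num a b) (sum_den a b).
Proof.
move=> a_gt0; rewrite /coprime -(eqn_pmul2r (gcd_add_mul_gt0 b a_gt0)) muln_gcdl.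
by rewrite sum_numK sum_denK mul1n.
Qed.

Lemma sum_num_den a b : 0 < a -> sum_num a b * (a * b) = sum_den a b * (a + b).
Proof.
move=> a_gt0; rewrite -(sum_denK a b) -[X in _ = _ * X](sum_numK a b); lia.
Qed.

(** This is 1/a + 1/b <= 2/a for the reduced fraction. *)
Lemma sum_numM_le a b : 0 < a -> a <= b -> sum_num a b * a <= 2 * sum_den a b.
Proof.
move=> a_gt0 ab; rewrite -(leq_pmul2r (leq_trans a_gt0 ab)) -mulnA.
by rewrite sum_num_den// [2 * _]mulnC -mulnA leq_mul2l mul2n -addnn leq_add2r ab orbT.
Qed.

Lemma sum_den_leM a b : sum_den a b <= a * b.
Proof. exact: leq_div. Qed.

Lemma sum_num_leD a b : sum_num a b <= a + b.
Proof. exact: leq_div. Qed.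

End SumFractions.

(** The first two terms of p/q = 1/a + 1/b + 1/c are merged into their reduced sum, by cancelling
    [gcd_add_mul a b]. *)
Lemma sum_fractions_eq a b c p q : 0 < a ->
  p * (a * b * c) = q * (b * c + a * c + a * b) ->
  q * (sum_num a b * c + sum_den a b) = p * (sum_den a b * c).
Proof.
move=> a_gt0 eq_q.
apply/eqP; rewrite -(eqn_pmul2r (gcd_add_mul_gt0 b a_gt0)); apply/eqP.
transitivity (q * ((a + b) * c + a * b)).
  by rewrite -(sum_numK a b) -(sum_denK a b); lia.
by have := eq_q; rewrite -(sum_denK a b); lia.
Qed.

(** In m/n = r1/s1 + r2/s2, cleared of denominators, every term but n r1 s2 is visibly a multiple of
    s1, and r1 is coprime to s1. *)
Lemma dvdn_den r1 s1 r2 s2 m n : coprime r1 s1 ->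
  n * (r1 * s2 + r2 * s1) = m * (s1 * s2) -> s1 %| n * s2.
Proof.
move=> co eq_n; rewrite coprime_sym in co.
rewrite -(Gauss_dvdr _ co) mulnCA -(dvdn_addl (n := n * (r2 * s1))).
  by rewrite -mulnDr eq_n mulnCA dvdn_mulr.
by rewrite mulnCA !dvdn_mull.
Qed.

(** The complementary factor is n s1 / s2. An unknown ratio of denominators thus becomes a divisor
    of a known number. *)
Lemma dvdn_quotient_sqr n s1 s2 : 0 < s1 -> s1 %| n * s2 -> s2 %| n * s1 ->
  n * s2 %/ s1 %| n ^ 2.
Proof.
move=> s1_gt0 dvd12 dvd21; rewrite -(dvdn_pmul2r s1_gt0) divnK//.
by rewrite -mulnn -mulnA dvdn_mul.
Qed.

(** This is t of the overview. It need not be coprime to n (n = 2 and a = 4 give 2), only to n /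
    gcd(a, n). *)
Definition free_part (n a : nat) := a %/ gcdn a n.

Section FreePart.
Variable n : nat.
Hypothesis n_gt0 : 0 < n.
Implicit Types a b : nat.
Local Notation t := (free_part n).

Lemma free_partK a : gcdn a n * t a = a.
Proof. by rewrite mulnC divnK ?dvdn_gcdl. Qed.

Lemma free_part_gt0 a : 0 < a -> 0 < t a.
Proof. by rewrite -{1}(free_partK a) muln_gt0 => /andP[]. Qed.

Lemma free_part_dvd a : t a %| a.
Proof. by rewrite -{2}(free_partK a) dvdn_mull. Qed.

Lemma dvdn_free_part a : a %| n * t a.
Proof. by rewrite -{1}(free_partK a) dvdn_mul ?dvdn_gcdr. Qed.

Lemma coprime_free_part a : coprime (t a) (n %/ gcdn a n).
Proof.
have g_gt0 : 0 < gcdn a n by rewrite gcdn_gt0 n_gt0 orbT.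
rewrite /coprime -(eqn_pmul2r g_gt0) muln_gcdl.
by rewrite !divnK ?dvdn_gcdl ?dvdn_gcdr ?mul1n.
Qed.

(** Both a and b divide n times their free parts. Knowing gcd(t(a), t(b)) therefore leaves few
    values for gcd(a, b). *)
Lemma dvdn_gcd_free_part a b : gcdn a b %| n * gcdn (t a) (t b).
Proof.
rewrite muln_gcdr dvdn_gcd.
by rewrite (dvdn_trans (dvdn_gcdl a b)) ?(dvdn_trans (dvdn_gcdr a b)) ?dvdn_free_part.
Qed.

(** Since g divides gcd(a, b), the quotient a / gcd(a, b) divides a / g = gcd(a, n) (t(a) / g). *)
Lemma dvdn_div_gcd_free_part a b : 0 < a ->
  a %/ gcdn a b %| n * (t a %/ gcdn (t a) (t b)).
Proof.
move=> a_gt0; set g := gcdn (t a) (t b).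
have gcd_gt0 : 0 < gcdn a b by rewrite gcdn_gt0 a_gt0.
have /dvdnP[k gcdE] : g %| gcdn a b.
  rewrite dvdn_gcd (dvdn_trans (dvdn_gcdl _ _)) ?free_part_dvd//.
  by rewrite (dvdn_trans (dvdn_gcdr _ _)) ?free_part_dvd.
apply: dvdn_trans (_ : gcdn a n * (t a %/ g) %| _); last by rewrite dvdn_mul ?dvdn_gcdr.
rewrite -(dvdn_pmul2r gcd_gt0) divnK ?dvdn_gcdl// gcdE.
have -> : gcdn a n * (t a %/ g) * (k * g) = gcdn a n * (t a %/ g * g) * k by lia.
by rewrite divnK ?dvdn_gcdl// free_partK dvdn_mulr.
Qed.

End FreePart.

(** * Prescribed numerators and prescribed ratios *)

Section Determination.
Variables (S : eqType) (M D : nat).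
Hypothesis tau_le : forall W, 0 < W <= M -> size (divisors W) <= D.
Implicit Types (P : S -> Prop) (K : nat).

(** For p/q = 1/a + 1/b + 1/c, the quotient k = q c / den(a, b) divides q^2, and p c = v k + q then
    gives c. What remains is a sum of two unit fractions of known value. *)
Lemma at_most_sum_num K P (a b c : S -> nat) p q v :
  (forall s, P s -> [/\ 0 < a s, 0 < b s & 0 < c s]) ->
  (forall s, P s -> p * (a s * b s * c s) = q * (b s * c s + a s * c s + a s * b s)) ->
  (forall s, P s -> [/\ 0 < q, q ^ 2 <= M & (q * c s) ^ 2 <= M]) ->
  (forall x y z, at_most K (fun s => [/\ P s, a s = x, b s = y & c s = z])) ->
  at_most (D * (D * K)) (fun s => P s /\ sum_num (a s) (b s) = v).
Proof.
move=> P_gt0 Peq PM abcK.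
pose k s := q * c s %/ sum_den (a s) (b s).
have Peq2 s : P s ->
    q * (sum_num (a s) (b s) * c s + 1 * sum_den (a s) (b s)) =
    p * (sum_den (a s) (b s) * c s).
  move=> Ps; have [a_gt0 _ _] := P_gt0 s Ps.
  by rewrite mul1n (sum_fractions_eq a_gt0 (Peq s Ps)).
have dvd1 s : P s -> sum_den (a s) (b s) %| q * c s.
  move=> Ps; have [a_gt0 b_gt0 c_gt0] := P_gt0 s Ps.
  exact: dvdn_den (coprime_sum_num_den _ a_gt0) (Peq2 s Ps).
have dvd2 s : P s -> c s %| q * sum_den (a s) (b s).
  move=> Ps; have := Peq2 s Ps; rewrite addnC [sum_den _ _ * c s]mulnC.
  by apply: dvdn_den; rewrite coprime1n.
have kK s : P s -> k s * sum_den (a s) (b s) = q * c s.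
  by move=> Ps; rewrite divnK ?dvd1.
have cE s : P s -> p * c s = sum_num (a s) (b s) * k s + q.
  move=> Ps; have [a_gt0 b_gt0 c_gt0] := P_gt0 s Ps.
  have den_gt0 := sum_den_gt0 a_gt0 b_gt0.
  apply/eqP; rewrite -(eqn_pmul2r den_gt0); apply/eqP.
  have := Peq2 s Ps; have := congr1 (muln (sum_num (a s) (b s))) (kK s Ps); lia.
apply: (at_most_dvd tau_le (g := k) (W := q ^ 2)) => [s [Ps _]|k0].
  have [a_gt0 b_gt0 _] := P_gt0 s Ps; have [q_gt0 qM _] := PM s Ps.
  by split; rewrite ?expn_gt0 ?q_gt0 ?dvdn_quotient_sqr ?sum_den_gt0 ?dvd1 ?dvd2.
pose c0 := (v * k0 + q) %/ p.
have c0E s : P s /\ sum_num (a s) (b s) = v /\ k s = k0 -> c s = c0.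
  move=> [Ps [sv ks]]; have [q_gt0 _ _] := PM s Ps.
  have p_gt0 : 0 < p.
    by rewrite lt0n; apply/eqP => p0; have := cE s Ps; rewrite p0; lia.
  by rewrite /c0 -sv -ks -cE// mulKn.
apply: (at_most_two_fractions tau_le (a := a) (b := b) (R := p * c0 - q) (E := q * c0)).
  move=> s [[Ps sv] ks]; have [a_gt0 b_gt0 c_gt0] := P_gt0 s Ps.
  have [q_gt0 _ qcM] := PM s Ps; rewrite -(c0E s)//; split; rewrite ?muln_gt0 ?q_gt0//.
  rewrite cE// addnK -kK//.
  by have /(congr1 (muln (k s))) := sum_num_den (b s) a_gt0; lia.
move=> x y; apply: sub_at_most (abcK x y c0) => s [[[Ps sv] ks] ax bY].
by split; rewrite // (c0E s).
Qed.

(** If a = x g and b = y g with g = gcd(a, b), then g divides gam(a, b), so num(a, b) divides x + y.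
    Prescribing it costs only one more factor D. *)
Lemma at_most_ratio K P (a b : S -> nat) W :
  (forall s, P s -> [/\ 0 < a s, 0 < b s, 0 < W & W <= M]) ->
  (forall s, P s -> a s %/ gcdn (a s) (b s) %| W) ->
  (forall s, P s -> b s %/ gcdn (a s) (b s) %| W) ->
  (forall s, P s -> a s + b s <= M) ->
  (forall x y z, at_most K (fun s => [/\ P s, a s %/ gcdn (a s) (b s) = x,
     b s %/ gcdn (a s) (b s) = y & sum_num (a s) (b s) = z])) ->
  at_most (D * (D * (D * K))) P.
Proof.
move=> P_gt0 aW bW abM abK.
apply: (at_most_dvd tau_le (W := W) (g := fun s => a s %/ gcdn (a s) (b s))).
  by move=> s Ps; have [] := P_gt0 s Ps; split; rewrite ?aW.
move=> x; apply: (at_most_dvd tau_le (W := W) (g := fun s => b s %/ gcdn (a s) (b s))).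
  by move=> s [Ps _]; have [] := P_gt0 s Ps; split; rewrite ?bW.
move=> y; apply: (at_most_dvd tau_le (W := x + y) (g := fun s => sum_num (a s) (b s))).
  move=> s [[Ps <-] <-]; have [a_gt0 b_gt0 _ _] := P_gt0 s Ps.
  set g := gcdn _ _; have g_gt0 : 0 < g by rewrite gcdn_gt0 a_gt0.
  have aK : a s %/ g * g = a s by rewrite divnK ?dvdn_gcdl.
  have bK : b s %/ g * g = b s by rewrite divnK ?dvdn_gcdr.
  split.
  - have g_dvd : g %| gcd_add_mul (a s) (b s).
      by rewrite dvdn_gcd dvdn_add ?dvdn_mulr ?dvdn_gcdl ?dvdn_gcdr.
    rewrite -(dvdn_pmul2r g_gt0) mulnDl aK bK -(sum_numK (a s) (b s)).
    by rewrite dvdn_mul.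
  - by rewrite addn_gt0 -(ltn_pmul2r g_gt0) aK mul0n a_gt0.
  - by apply: leq_trans (abM s Ps); rewrite leq_add// leq_div.
by move=> z; apply: sub_at_most (abK x y z) => s [[[]]].
Qed.

End Determination.

(** * Three unit fractions *)

Lemma gcdnM_dvd a b n : gcdn (a * b) n %| gcdn a n * gcdn b n.
Proof.
set d := gcdn _ _; have dn : d %| n by apply: dvdn_gcdr.
have /dvdn_gcd_factor : d %| a * b by apply: dvdn_gcdl.
rewrite mulnC => /dvdn_gcd_factor /dvdn_trans; apply; rewrite mulnC.
by rewrite dvdn_mul// dvdn_gcd dvdn_gcdr (dvdn_trans (dvdn_gcdl _ _)).
Qed.

(** Cancelling the common factors with q turns p/q = r/s + 1/c into the identity [key]. Modulo t(s)
    it leaves (q / gcd(s, q)) t(c) r, where r and q / gcd(s, q) are coprime to t(s). *)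
Lemma free_part_dvd_free_part r s c p q : 0 < q -> 0 < s -> 0 < c -> coprime r s ->
  q * (r * c + s) = p * (s * c) -> free_part q s %| free_part q c.
Proof.
move=> q_gt0 s_gt0 c_gt0 co eq_q.
have n_gt0 x : 0 < gcdn x q by rewrite gcdn_gt0 q_gt0 orbT.
have qE x : gcdn x q * (q %/ gcdn x q) = q by rewrite mulnC divnK ?dvdn_gcdr.
have key : q %/ gcdn s q * free_part q c * r + q %/ gcdn c q * free_part q s =
    p * free_part q s * free_part q c.
  apply/eqP; rewrite -(eqn_pmul2l (n_gt0 s)) -(eqn_pmul2l (n_gt0 c)); apply/eqP.
  transitivity (gcdn s q * (q %/ gcdn s q) * r * (gcdn c q * free_part q c) +
    gcdn c q * (q %/ gcdn c q) * (gcdn s q * free_part q s)); first by lia.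
  rewrite !free_partK !qE; transitivity (p * (s * c)); first by rewrite -eq_q; lia.
  by rewrite -{1}(free_partK q s) -{1}(free_partK q c); lia.
have co1 : coprime (free_part q s) (q %/ gcdn s q) by apply: coprime_free_part.
have co2 : coprime (free_part q s) r.
  by rewrite coprime_sym; apply: coprime_dvdr co; apply: free_part_dvd.
rewrite -(Gauss_dvdr _ co1) -(Gauss_dvdl _ co2).
rewrite -(dvdn_addl (n := q %/ gcdn c q * free_part q s)) ?dvdn_mull//.
by rewrite key mulnAC dvdn_mull.
Qed.

Section ThreeFractionsInequality.
Variables (a b c p q : nat).
Hypotheses (a_gt0 : 0 < a) (b_gt0 : 0 < b) (c_gt0 : 0 < c) (q_gt0 : 0 < q).
Hypothesis eq_q : p * (a * b * c) = q * (b * c + a * c + a * b).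
Local Notation t := (free_part q).

(** The factor gcd(den(a, b), q) divides gcd(a, q) gcd(b, q), and the cofactor t(den(a, b)) divides
    t(c). *)
Lemma sum_den_le_free : sum_den a b <= gcdn a q * gcdn b q * t c.
Proof.
have s_gt0 : 0 < sum_den a b by rewrite sum_den_gt0.
rewrite -(free_partK q (sum_den a b)) leq_mul// dvdn_leq ?free_part_gt0//.
- by rewrite muln_gt0 !gcdn_gt0 q_gt0 !orbT.
- apply: dvdn_trans (gcdnM_dvd a b q); rewrite dvdn_gcd dvdn_gcdr andbT.
  apply: dvdn_trans (dvdn_gcdl _ _) _.
  by rewrite -(sum_denK a b) dvdn_mulr.
- apply: (@free_part_dvd_free_part (sum_num a b) _ _ p) => //.
    exact: coprime_sum_num_den.
  exact: sum_fractions_eq.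
Qed.

(* A prime power exceeding its exponent in q cannot occur in only one of the
   denominators. *)
Lemma free_part_dvd_lcm : t c * gcdn (t a) (t b) %| t a * t b.
Proof.
have n_gt0 x : 0 < gcdn x q by rewrite gcdn_gt0 q_gt0 orbT.
have qE x : gcdn x q * (q %/ gcdn x q) = q by rewrite mulnC divnK ?dvdn_gcdr.
have key : p * t a * t b * t c = q %/ gcdn a q * t b * t c +
    q %/ gcdn b q * t a * t c + q %/ gcdn c q * t a * t b.
  apply/eqP; rewrite -(eqn_pmul2l (n_gt0 a)) -(eqn_pmul2l (n_gt0 b)).
  rewrite -(eqn_pmul2l (n_gt0 c)); apply/eqP.
  transitivity (p * ((gcdn a q * t a) * (gcdn b q * t b) * (gcdn c q * t c))).
    by lia.
  rewrite !free_partK eq_q.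
  transitivity (gcdn a q * (q %/ gcdn a q) * (gcdn b q * t b) * (gcdn c q * t c) +
    gcdn b q * (q %/ gcdn b q) * (gcdn a q * t a) * (gcdn c q * t c) +
    gcdn c q * (q %/ gcdn c q) * (gcdn a q * t a) * (gcdn b q * t b)); last by lia.
  by rewrite !free_partK !qE; lia.
have g_gt0 : 0 < gcdn (t a) (t b) by rewrite gcdn_gt0 free_part_gt0.
rewrite -(muln_lcm_gcd (t a) (t b)) dvdn_pmul2r//.
rewrite -(Gauss_dvdr _ (coprime_free_part q_gt0 c)) -(dvdn_pmul2r g_gt0) -mulnA.
rewrite muln_lcm_gcd mulnA -(dvdn_addr (m := q %/ gcdn a q * t b * t c +
  q %/ gcdn b q * t a * t c)).
  by rewrite -key mulnC dvdn_mul// -!mulnA dvdn_mull// dvdn_mulr// dvdn_gcdl.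
by rewrite dvdn_add// mulnC dvdn_mul// dvdn_mull ?dvdn_gcdl ?dvdn_gcdr.
Qed.

End ThreeFractionsInequality.

(** Let G = gcd(t(a), t(b)) and g = gcd(t(b), t(c)). Multiplied by g^2, the left side is num(a,b)
    num(b,c) t(b) t(c) G^2, which [ineq3] and [ineq4] bound by 4 q (t(a) g)^2. Cancelling g^2 and
    using t(a) <= a <= 3 q gives the constant 36. *)
Lemma three_fractions_inequality a b c p q :
  0 < a -> a <= b -> b <= c -> 0 < p -> 0 < q ->
  p * (a * b * c) = q * (b * c + a * c + a * b) ->
  sum_num a b * sum_num b c * gcdn (free_part q a) (free_part q b) ^ 2 *
    (free_part q b %/ gcdn (free_part q b) (free_part q c) *
     (free_part q c %/ gcdn (free_part q b) (free_part q c))) <= 36 * q ^ 3.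
Proof.
move=> a_gt0 ab bc p_gt0 q_gt0 eq_q.
pose t := free_part q; rewrite -!/(t _); set g := gcdn (t b) (t c).
have b_gt0 := leq_trans a_gt0 ab; have c_gt0 := leq_trans b_gt0 bc.
have n_gt0 x : 0 < gcdn x q by rewrite gcdn_gt0 q_gt0 orbT.
have ta_gt0 : 0 < t a by apply: free_part_gt0.
have tb_gt0 : 0 < t b by apply: free_part_gt0.
have g_gt0 : 0 < g by rewrite gcdn_gt0 tb_gt0.
have ineq1 : sum_num a b * t a <= 2 * gcdn b q * t c.
  have := leq_trans (sum_numM_le a_gt0 ab)
    (leq_mul (leqnn 2) (sum_den_le_free a_gt0 b_gt0 c_gt0 q_gt0 eq_q)).
  rewrite -{2}(free_partK q a) -/(t a) => le1.
  rewrite -(leq_pmul2l (n_gt0 a)); apply: leq_trans (leq_trans _ le1) _; last by rewrite -/(t c); lia.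
  by rewrite mulnCA.
have ineq2 : sum_num b c * (gcdn b q * t b) <= 2 * (q * t a).
  rewrite free_partK; apply: leq_trans (sum_numM_le b_gt0 bc) _.
  have s_gt0 : 0 < sum_den b c by rewrite sum_den_gt0.
  rewrite leq_mul2l /= -(free_partK q (sum_den b c)) leq_mul//.
    by rewrite dvdn_leq ?dvdn_gcdr.
  rewrite dvdn_leq//; apply: (@free_part_dvd_free_part (sum_num b c) _ _ p) => //.
    exact: coprime_sum_num_den.
  apply: sum_fractions_eq => //.
  have -> : b * c * a = a * b * c by lia.
  by rewrite eq_q; lia.
have ineq3 : sum_num a b * sum_num b c * t b <= 4 * q * t c.
  have pos : 0 < t a * gcdn b q by rewrite muln_gt0 ta_gt0 n_gt0.
  rewrite -(leq_pmul2r pos); have := leq_mul ineq1 ineq2; lia.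
(* t(a) g is the gcd of t(a) t(b) and t(a) t(c), and t(c) G divides both. *)
have ineq4 : t c * gcdn (t a) (t b) <= t a * g.
  rewrite dvdn_leq ?muln_gt0 ?ta_gt0// [X in _ %| X]muln_gcdr dvdn_gcd.
  by rewrite (free_part_dvd_lcm a_gt0 b_gt0 c_gt0 q_gt0 eq_q) mulnC dvdn_mul// dvdn_gcdl.
have a_le : a <= 3 * q.
  have : p * a * (b * c) <= 3 * q * (b * c).
    have : a * c <= b * c by rewrite leq_mul2r ab orbT.
    have : a * b <= b * c by rewrite mulnC leq_mul2l (leq_trans ab bc) orbT.
    move=> le1 le2; have -> : p * a * (b * c) = p * (a * b * c) by lia.
    by rewrite eq_q -[3 * q]mulnC -mulnA leq_mul2l; lia.
  rewrite leq_pmul2r ?muln_gt0 ?b_gt0// => /(leq_trans _); apply.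
  by rewrite leq_pmull.
have ta_le : t a <= 3 * q.
  by apply: leq_trans a_le; rewrite dvdn_leq ?free_part_dvd.
have bK : t b %/ g * g = t b by rewrite divnK ?dvdn_gcdl.
have cK : t c %/ g * g = t c by rewrite divnK ?dvdn_gcdr.
apply: leq_trans (_ : 4 * q * (t a) ^ 2 <= _); last first.
  apply: leq_trans (_ : 4 * q * (3 * q) ^ 2 <= _); last by lia.
  by rewrite leq_mul2l leq_sqr ta_le orbT.
have g2_gt0 : 0 < g ^ 2 by rewrite expn_gt0 g_gt0.
rewrite -(leq_pmul2r g2_gt0); set G := gcdn (t a) (t b).
apply: leq_trans (_ : sum_num a b * sum_num b c * t b * (t c * G ^ 2) <= _).
  by rewrite -{2}bK -{2}cK; apply: eq_leq; lia.
apply: leq_trans (leq_mul ineq3 (leqnn _)) _.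
have -> : 4 * q * t c * (t c * G ^ 2) = 4 * q * (t c * G) ^ 2 by lia.
have -> : 4 * q * t a ^ 2 * g ^ 2 = 4 * q * (t a * g) ^ 2 by lia.
by rewrite leq_mul2l leq_sqr ineq4 orbT.
Qed.

Lemma divn_gcdl_gt0 a b : 0 < a -> 0 < a %/ gcdn a b.
Proof. by move=> a_gt0; rewrite divn_gt0 ?gcdn_gt0 ?a_gt0// dvdn_leq ?dvdn_gcdl. Qed.

Lemma divn_gcdr_gt0 a b : 0 < b -> 0 < b %/ gcdn a b.
Proof. by rewrite gcdnC; apply: divn_gcdl_gt0. Qed.

Section PowerBounds.
Variable B : nat.
Hypothesis B_gt1 : 1 < B.

Lemma leq_mul_pow x y i j : x <= B ^ i -> y <= B ^ j -> x * y <= B ^ (i + j).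
Proof. by move=> xi yj; rewrite expnD leq_mul. Qed.

Lemma leq_exp_pow x k i : x <= B ^ i -> x ^ k <= B ^ (i * k).
Proof. by case: k => [|k] xi; rewrite ?muln0// expnM leq_exp2r. Qed.

Lemma leq_pow_trans x i j : i <= j -> x <= B ^ i -> x <= B ^ j.
Proof. by move=> ij xi; apply: leq_trans xi _; rewrite leq_exp2l. Qed.

Lemma leq_add_pow x y i : x <= B ^ i -> y <= B ^ i -> x + y <= B ^ i.+1.
Proof.
move=> xi yi; rewrite expnS; apply: leq_trans (leq_add xi yi) _.
by rewrite addnn -mul2n leq_mul2r B_gt1 orbT.
Qed.

End PowerBounds.

(** * Determining parameters for three fractions *)

Section ThreeFractions.
Variables (S : eqType) (M D B : nat).
Hypothesis tau_le : forall W, 0 < W <= M -> size (divisors W) <= D.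
(* B bounds the denominators; every number whose divisors get enumerated below
   is at most B ^ 12. *)
Hypotheses (B_gt1 : 1 < B) (BM : B ^ 12 <= M).

Let leM i x : i <= 12 -> x <= B ^ i -> x <= M.
Proof. by move=> i12 /(leq_pow_trans B_gt1 i12)/leq_trans; apply. Qed.

Let leB1 x : x <= B -> x <= B ^ 1. Proof. by rewrite expn1. Qed.

Variables (P : S -> Prop) (a b c : S -> nat) (p q : nat).
Hypotheses (p_gt0 : 0 < p) (q_gt0 : 0 < q) (pB : p <= B ^ 2) (qB : q <= B ^ 2).
Hypothesis P_gt0 : forall s, P s -> [/\ 0 < a s, 0 < b s & 0 < c s].
Hypothesis PB : forall s, P s -> [/\ a s <= B, b s <= B & c s <= B].
Hypothesis Peq : forall s, P s ->
  p * (a s * b s * c s) = q * (b s * c s + a s * c s + a s * b s).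
Hypothesis P1 : forall x y z, at_most 1 (fun s => [/\ P s, a s = x, b s = y & c s = z]).
Local Notation t := (free_part q).

(** gcd(a, b) divides q v. Once it is fixed, [at_most_three_fractions] applies with 1/a in the role
    of R/E. *)
Lemma at_most_gcd_free_part v :
  at_most (D ^ 3) (fun s => P s /\ gcdn (t (a s)) (t (b s)) = v).
Proof.
rewrite (_ : D ^ 3 = D * (D * (D * 1))); last by lia.
apply: (at_most_dvd tau_le (g := fun s => gcdn (a s) (b s)) (W := q * v)).
  move=> s [Ps <-]; have [a_gt0 b_gt0 c_gt0] := P_gt0 Ps; have [aB bB cB] := PB Ps.
  rewrite dvdn_gcd_free_part muln_gt0 q_gt0 gcdn_gt0 free_part_gt0//; split=> //.
  apply: (leM (i := 2 + 1)) => //; apply: leq_mul_pow => //; apply: leB1.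
  apply: leq_trans aB; apply: leq_trans (_ : t (a s) <= _).
    by rewrite dvdn_leq ?free_part_gt0 ?dvdn_gcdl.
  by rewrite dvdn_leq ?free_part_dvd.
move=> e; apply: (at_most_three_fractions tau_le (E := a) (a := b) (b := c)
  (R := 1) (p := p) (q := q) (e := e)).
- by move=> s [[/P_gt0]].
- by move=> s [].
- by move=> s [[/Peq]]; lia.
- move=> s [[Ps _] <-]; have [aB bB cB] := PB Ps.
  have [a_gt0 b_gt0 c_gt0] := P_gt0 Ps.
  have gB : gcdn (a s) (b s) <= B ^ 1.
    by apply/leB1/(leq_trans _ aB); rewrite dvdn_leq ?dvdn_gcdl.
  have q1B : q ^ 3 * 1 <= B ^ (2 * 3) by rewrite muln1 leq_exp_pow.
  have q2B : q ^ 2 * 1 <= B ^ (2 * 2) by rewrite muln1 leq_exp_pow.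
  have W1 := leq_mul_pow q1B gB.
  have W2 := leq_mul_pow (leq_mul_pow pB gB) W1.
  split=> //; first exact: leM W1.
  by apply: (leM _ (leq_add_pow B_gt1 W2 (leq_pow_trans B_gt1 _ q2B))).
- by move=> x y z; apply: sub_at_most (@P1 x y z) => s [[[]]].
Qed.

Lemma at_most_first_num v : at_most (D ^ 2) (fun s => P s /\ sum_num (a s) (b s) = v).
Proof.
rewrite (_ : D ^ 2 = D * (D * 1)); last by lia.
apply: (at_most_sum_num tau_le P_gt0 Peq _ P1) => s Ps; have [_ _ cB] := PB Ps.
split=> //; first by apply: leM (leq_exp_pow _ qB).
by apply: leM (leq_exp_pow _ (leq_mul_pow qB (leB1 cB))).
Qed.

End ThreeFractions.

Section ThreeFractionsCount.
Variables (S : eqType) (M D B : nat).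
Hypothesis tau_le : forall W, 0 < W <= M -> size (divisors W) <= D.
Hypotheses (B_gt1 : 1 < B) (BM : B ^ 12 <= M).

Let leM i x : i <= 12 -> x <= B ^ i -> x <= M.
Proof. by move=> i12 /(leq_pow_trans B_gt1 i12)/leq_trans; apply. Qed.

Let leB1 x : x <= B -> x <= B ^ 1. Proof. by rewrite expn1. Qed.

Variables (P : S -> Prop) (a b c : S -> nat) (p q : nat).
Hypotheses (p_gt0 : 0 < p) (q_gt0 : 0 < q) (pB : p <= B ^ 2) (qB : q <= B ^ 2).
Hypothesis P_le : forall s, P s -> [/\ 0 < a s, a s <= b s, b s <= c s & c s <= B].
Hypothesis Peq : forall s, P s ->
  p * (a s * b s * c s) = q * (b s * c s + a s * c s + a s * b s).
Hypothesis P1 : forall x y z, at_most 1 (fun s => [/\ P s, a s = x, b s = y & c s = z]).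
Local Notation t := (free_part q).

Let P_gt0 s : P s -> [/\ 0 < a s, 0 < b s & 0 < c s].
Proof. by case/P_le => *; split; lia. Qed.

Let PB s : P s -> [/\ a s <= B, b s <= B & c s <= B].
Proof. by case/P_le => *; split; lia. Qed.

Let Peq' s : P s -> p * (b s * c s * a s) = q * (c s * a s + b s * a s + b s * c s).
Proof. by move/Peq; lia. Qed.

Lemma at_most_last_num v : at_most (D ^ 2) (fun s => P s /\ sum_num (b s) (c s) = v).
Proof.
apply: (at_most_first_num tau_le B_gt1 BM p_gt0 q_gt0 pB qB _ _ Peq') => [s /P_gt0[]|s /PB[]|x y z] //.
by apply: sub_at_most (@P1 z x y) => s [].
Qed.

(** The reduced ratio b/c has both entries dividing q v, which brings [at_most_ratio] down to a
    prescribed num(b, c), already known to be determining. *)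
Lemma at_most_cofactors v : at_most (D ^ 5) (fun s => P s /\
  t (b s) %/ gcdn (t (b s)) (t (c s)) * (t (c s) %/ gcdn (t (b s)) (t (c s))) = v).
Proof.
rewrite (_ : D ^ 5 = D * (D * (D * D ^ 2))); last by lia.
apply: (at_most_ratio tau_le (a := b) (b := c) (W := q * v)) => [s [Ps <-]|s [Ps <-]|s [Ps <-]|s [Ps _]|x y z].
- have [a_gt0 b_gt0 c_gt0] := P_gt0 Ps; have [aB bB cB] := PB Ps.
  have tb_gt0 : 0 < t (b s) by apply: free_part_gt0.
  have tc_gt0 : 0 < t (c s) by apply: free_part_gt0.
  have g_gt0 : 0 < gcdn (t (b s)) (t (c s)) by rewrite gcdn_gt0 tb_gt0.
  split=> //.
    by rewrite !muln_gt0 q_gt0 divn_gcdl_gt0 ?divn_gcdr_gt0.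
  apply: (leM (i := 2 + (1 + 1))) => //.
  have tle x : 0 < x -> x <= B -> t x %/ gcdn (t (b s)) (t (c s)) <= B ^ 1.
    move=> x_gt0 xB; apply/leB1/(leq_trans (leq_div _ _))/(leq_trans _ xB).
    by rewrite dvdn_leq ?free_part_dvd.
  by rewrite !leq_mul_pow ?tle.
- have [_ b_gt0 _] := P_gt0 Ps.
  by apply: dvdn_trans (dvdn_div_gcd_free_part q_gt0 _ b_gt0) _; rewrite mulnA dvdn_mulr.
- have [_ _ c_gt0] := P_gt0 Ps; rewrite gcdnC [gcdn (t _) _]gcdnC.
  apply: dvdn_trans (dvdn_div_gcd_free_part q_gt0 _ c_gt0) _.
  by rewrite dvdn_mul// dvdn_mull.
- have [aB bB cB] := PB Ps.
  by apply: leM (leq_add_pow B_gt1 (leB1 bB) (leB1 cB)).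
- by apply: sub_at_most (at_most_last_num (v:=z)) => s [[]].
Qed.

Lemma at_most_three : 0 < D ->
  exists2 Y, Y ^ 5 <= 36 * q ^ 3 & at_most (Y * (4 * D ^ 5)) P.
Proof.
move=> D_gt0; have [Y Y_le Y_max] := exists_root (36 * q ^ 3) (isT : 0 < 5) (isT : 0 < 1).
rewrite muln1 in Y_le; exists Y => //.
pose f1 s := sum_num (a s) (b s); pose f2 s := sum_num (b s) (c s).
pose f3 s := gcdn (t (a s)) (t (b s)).
pose f4 s := t (b s) %/ gcdn (t (b s)) (t (c s)) * (t (c s) %/ gcdn (t (b s)) (t (c s))).
have f_gt0 s : P s -> [/\ 0 < f1 s, 0 < f2 s, 0 < f3 s & 0 < f4 s].
  move=> Ps; have [a_gt0 b_gt0 c_gt0] := P_gt0 Ps.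
  have tb_gt0 : 0 < t (b s) by apply: free_part_gt0.
  have tc_gt0 : 0 < t (c s) by apply: free_part_gt0.
  have g_gt0 : 0 < gcdn (t (b s)) (t (c s)) by rewrite gcdn_gt0 tb_gt0.
  rewrite /f1 /f2 /f3 /f4 !sum_num_gt0// gcdn_gt0 tb_gt0 orbT; split=> //.
  by rewrite !muln_gt0 divn_gcdl_gt0 ?divn_gcdr_gt0.
have f_le s : P s -> f1 s * f2 s * f3 s ^ 2 * f4 s <= 36 * q ^ 3.
  by move=> Ps; have [? ? ? _] := P_le Ps; apply: three_fractions_inequality (Peq Ps).
(* The exponents in f1 f2 f3^2 f4 add up to 5, so if all four parameters exceeded Y, then (Y + 1)^5
   would be admissible too. *)
have small s : P s -> f1 s <= Y \/ (f2 s <= Y \/ (f3 s <= Y \/ f4 s <= Y)).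
  move=> Ps; have [x1 x2 x3 x4] := f_gt0 s Ps; have := f_le s Ps.
  move: (f1 s) (f2 s) (f3 s) (f4 s) x1 x2 x3 x4 => x1 x2 x3 x4 gt1 gt2 gt3 gt4 x_le.
  case: (leqP x1 Y) => [|lt1]; first by left.
  case: (leqP x2 Y) => [|lt2]; first by right; left.
  case: (leqP x3 Y) => [|lt3]; first by right; right; left.
  case: (leqP x4 Y) => [|lt4]; first by right; right; right.
  suff /Y_max : Y.+1 ^ 5 * 1 <= 36 * q ^ 3 by rewrite ltnn.
  rewrite muln1; apply: leq_trans x_le; rewrite (_ : Y.+1 ^ 5 = Y.+1 * Y.+1 * Y.+1 ^ 2 * Y.+1); last by lia.
  by rewrite !leq_mul// leq_sqr.
have K2 : D ^ 2 <= D ^ 5 by rewrite leq_pexp2l.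
have K3 : D ^ 3 <= D ^ 5 by rewrite leq_pexp2l.
have fib f k : D ^ k <= D ^ 5 -> (forall s, P s -> 0 < f s) ->
    (forall v, at_most (D ^ k) (fun s => P s /\ f s = v)) ->
    at_most (Y * D ^ 5) (fun s => P s /\ f s <= Y).
  move=> kle fgt0 fk; apply: (at_most_leq (g := f)) => [s [Ps fY]|v].
    by rewrite fY fgt0.
  by apply: (leq_at_most kle); apply: sub_at_most (fk v) => s [[]].
have -> : Y * (4 * D ^ 5) = Y * D ^ 5 + (Y * D ^ 5 + (Y * D ^ 5 + Y * D ^ 5)) by lia.
apply: (at_mostU small).
  by apply: (fib f1 2) => // [s /f_gt0[]//|]; move=> v; exact (at_most_first_num tau_le B_gt1 BM p_gt0 q_gt0 pB qB P_gt0 PB Peq P1 (v:=v)).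
apply: (at_mostU (Q1 := fun s => f2 s <= Y) (Q2 := fun s => f3 s <= Y \/ f4 s <= Y)).
- by move=> s [].
- apply: sub_at_most (fib f2 2 _ _ _) => // [s [[]]|s /f_gt0[]|] //.
  by move=> v; exact (at_most_last_num (v:=v)).
apply: (at_mostU (Q1 := fun s => f3 s <= Y) (Q2 := fun s => f4 s <= Y)).
- by move=> s [[]].
- apply: sub_at_most (fib f3 3 _ _ _) => // [s [[[]]]|s /f_gt0[]|] //.
  by move=> v; exact (at_most_gcd_free_part tau_le B_gt1 BM p_gt0 q_gt0 pB qB P_gt0 PB Peq P1 (v:=v)).
- apply: sub_at_most (fib f4 5 _ _ _) => // [s [[[]]]|s /f_gt0[]|] //.
  by move=> v; exact (at_most_cofactors (v:=v)).
Qed.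

End ThreeFractionsCount.

(** * Four unit fractions *)

Definition four_eq (m n a b c d : nat) : Prop :=
  m * (a * b * c * d) = n * (b * c * d + a * c * d + a * b * d + a * b * c).

(** None of the four fractions exceeds 1/a. *)
Lemma four_eq_first_le m n a b c d : 0 < a -> a <= b -> b <= c -> c <= d ->
  four_eq m n a b c d -> m * a <= 4 * n.
Proof.
move=> a_gt0 ab bc cd eq4.
have b_gt0 := leq_trans a_gt0 ab; have c_gt0 := leq_trans b_gt0 bc.
have bcd_gt0 : 0 < b * c * d by rewrite !muln_gt0 b_gt0 c_gt0 (leq_trans c_gt0).
rewrite -(leq_pmul2r bcd_gt0); have := eq4; rewrite /four_eq.
have l1 : a * c * d <= b * c * d by rewrite !leq_mul.
have l2 : a * b * d <= b * c * d by rewrite [a * b]mulnC !leq_mul// (leq_trans ab).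
have l3 : a * b * c <= b * c * d.
  by rewrite -mulnA mulnC leq_mul// (leq_trans ab)// (leq_trans bc).
have -> : m * a * (b * c * d) = m * (a * b * c * d) by lia.
move=> ->; have -> : 4 * n * (b * c * d) =
  n * (b * c * d + b * c * d + b * c * d + b * c * d) by lia.
by rewrite leq_mul2l !leq_add ?orbT.
Qed.

(** Removing 1/a leaves (m a - n)/(n a) = 1/b + 1/c + 1/d, which is at most 3/b. *)
Lemma four_eq_second_le m n a b c d : 0 < a -> a <= b -> b <= c -> c <= d ->
  four_eq m n a b c d -> (m * a - n) * b <= 3 * (n * a).
Proof.
move=> a_gt0 ab bc cd eq4.
have b_gt0 := leq_trans a_gt0 ab; have c_gt0 := leq_trans b_gt0 bc.
have cd_gt0 : 0 < c * d by rewrite muln_gt0 c_gt0 (leq_trans c_gt0).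
rewrite -(leq_pmul2r cd_gt0).
have -> : (m * a - n) * b * (c * d) = n * a * (c * d + b * d + b * c).
  rewrite !mulnBl (_ : m * a * b * (c * d) =
    n * a * (c * d + b * d + b * c) + n * b * (c * d)) ?addnK//.
  by have := eq4; rewrite /four_eq; clear; lia.
have bd : b * d <= c * d by rewrite leq_mul2r bc orbT.
have bcd : b * c <= c * d by rewrite mulnC leq_mul2l (leq_trans bc cd) orbT.
have -> : 3 * (n * a) * (c * d) = n * a * (c * d + c * d + c * d) by lia.
by rewrite leq_mul2l !leq_add ?orbT.
Qed.

Section FourEq.
Variables (m n a b c d : nat).
Hypotheses (m_gt0 : 0 < m) (n_gt0 : 0 < n).
Hypotheses (a_gt0 : 0 < a) (b_gt0 : 0 < b) (c_gt0 : 0 < c) (d_gt0 : 0 < d).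
Hypothesis eq4 : four_eq m n a b c d.

Lemma four_eq_subl : (m * a - n) * (b * c * d) = n * a * (c * d + b * d + b * c).
Proof. by have := eq4; rewrite /four_eq mulnBl => eqn; nia. Qed.

(** The term 1/a is smaller than the whole sum. This makes the truncated [m * a - n] a genuine
    difference. *)
Lemma four_eq_lt : n < m * a.
Proof.
have : 0 < n * a * (c * d + b * d + b * c) by rewrite !muln_gt0 n_gt0 a_gt0 !addn_gt0 !muln_gt0 c_gt0 d_gt0.
by rewrite -four_eq_subl muln_gt0 subn_gt0 => /andP[].
Qed.

Lemma four_eq_sum2 :
  m * (sum_den b c * a * d) = n * (sum_num b c * a * d + sum_den b c * d + sum_den b c * a).
Proof.
apply/eqP; rewrite -(eqn_pmul2r (gcd_add_mul_gt0 c b_gt0)); apply/eqP.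
transitivity (n * ((b + c) * a * d + b * c * d + b * c * a)); last first.
  by rewrite -(sum_numK b c) -(sum_denK b c); lia.
transitivity (m * (sum_den b c * gcd_add_mul b c * a * d)); first by lia.
by rewrite sum_denK; have := eq4; rewrite /four_eq; lia.
Qed.

Lemma four_eq_last : m * a * b * sum_den c d =
  n * (a + b) * sum_den c d + n * (a * b) * sum_num c d.
Proof.
apply/eqP; rewrite -(eqn_pmul2r (gcd_add_mul_gt0 d c_gt0)); apply/eqP.
transitivity (n * (a + b) * (c * d) + n * (a * b) * (c + d)); last first.
  by rewrite -(sum_numK c d) -(sum_denK c d); lia.
transitivity (m * (a * b * (sum_den c d * gcd_add_mul c d))); first by lia.
by rewrite sum_denK; have := eq4; rewrite /four_eq; lia.
Qed.

Lemma four_eq_num_den :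
  n * (sum_num a b * sum_den c d + sum_num c d * sum_den a b) =
  m * (sum_den a b * sum_den c d).
Proof.
apply/eqP; rewrite -(eqn_pmul2r (gcd_add_mul_gt0 b a_gt0)); apply/eqP.
transitivity (m * a * b * sum_den c d); last first.
  by rewrite -(mulnA m) -(sum_denK a b); lia.
by rewrite four_eq_last -(sum_denK a b) -(sum_numK a b); lia.
Qed.

Lemma sum_den_dvdr : sum_den a b %| n * sum_den c d.
Proof. exact: dvdn_den (coprime_sum_num_den _ a_gt0) four_eq_num_den. Qed.

Lemma sum_den_dvdl : sum_den c d %| n * sum_den a b.
Proof.
apply: (@dvdn_den (sum_num c d) _ (sum_num a b) _ m) => //.
  exact: coprime_sum_num_den.
by rewrite addnC four_eq_num_den [sum_den c d * _]mulnC.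
Qed.

(* (m a - n) (m b - n) = n^2 + m X with X = m a b - n (a + b), and X is n a b times
   the sum of the last two fractions. *)
Lemma four_eq_prod :
  n * sum_den c d %/ sum_den a b * ((m * a - n) * (m * b - n)) =
  n ^ 2 * (n * sum_den c d %/ sum_den a b + m * (sum_num c d * gcd_add_mul a b)).
Proof.
set k := _ %/ _.
have sab_gt0 : 0 < sum_den a b by rewrite sum_den_gt0.
have scd_gt0 : 0 < sum_den c d by rewrite sum_den_gt0.
have kK : k * sum_den a b = n * sum_den c d by rewrite divnK ?sum_den_dvdr.
have [X XE] : exists X, m * a * b = n * (a + b) + X.
  exists (m * a * b - n * (a + b)); rewrite subnKC//.
  by rewrite -(leq_pmul2r scd_gt0) four_eq_last leq_addr.
have scdX : X * sum_den c d = n * (a * b) * sum_num c d.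
  have := four_eq_last; rewrite XE mulnDl; lia.
have kX : k * X = n ^ 2 * (sum_num c d * gcd_add_mul a b).
  apply/eqP; rewrite -(eqn_pmul2r sab_gt0); apply/eqP.
  transitivity (n * (X * sum_den c d)); first by rewrite mulnAC kK; lia.
  by rewrite scdX -(sum_denK a b); lia.
have ma_gt : n <= m * a by apply/ltnW/four_eq_lt.
have mb_gt : n <= m * b.
  rewrite -(leq_pmul2r a_gt0); have : m * b * a = m * a * b by lia.
  by move=> ->; rewrite XE; lia.
have y12 : (m * a - n) * (m * b - n) = n ^ 2 + m * X.
  have [y yE] : exists y, m * a = y + n by exists (m * a - n); rewrite subnK.
  have [z zE] : exists z, m * b = z + n by exists (m * b - n); rewrite subnK.
  rewrite yE zE !addnK.
  suff : (y + n) * (z + n) = n * (y + n) + n * (z + n) + m * X by lia.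
  rewrite -yE -zE (_ : m * a * (m * b) = m * (m * a * b)); last by lia.
  by rewrite XE; lia.
by rewrite y12 mulnDr; have := congr1 (muln m) kX; lia.
Qed.

End FourEq.

(** Since t(x) <= x, f_1^2 f_2 is at most (a - floor(n/m))^2 b c; and f_3 c <= 2 n a b because
    den(c, d) divides n den(a, b). After c cancels, the size relations lead to 72 n^3 (m a)^3 <=
    4608 n^6. *)
Lemma four_fractions_inequality m n a b c d :
  0 < m -> 0 < n -> 0 < a -> a <= b -> b <= c -> c <= d ->
  four_eq m n a b c d -> m <= m * a - n ->
  ((a - n %/ m) * (gcdn (free_part n b) (free_part n c) %/
     gcdn (free_part n a) (gcdn (free_part n b) (free_part n c)))) ^ 2 *
  (free_part n b %/ gcdn (free_part n b) (free_part n c) *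
   (free_part n c %/ gcdn (free_part n b) (free_part n c)) *
   gcdn (free_part n a) (gcdn (free_part n b) (free_part n c))) *
  (sum_num c d * gcd_add_mul a b) * m ^ 5 <= 4608 * n ^ 6.
Proof.
move=> m_gt0 n_gt0 a_gt0 ab bc cd eq4 y_ge.
have b_gt0 := leq_trans a_gt0 ab; have c_gt0 := leq_trans b_gt0 bc.
have d_gt0 := leq_trans c_gt0 cd.
pose t := free_part n; rewrite -!/(t _).
set g := gcdn (t b) (t c); set w := gcdn (t a) g; set j := a - n %/ m.
have tb_gt0 : 0 < t b by apply: free_part_gt0.
have ta_gt0 : 0 < t a by apply: free_part_gt0.
have w_gt0 : 0 < w by rewrite gcdn_gt0 ta_gt0.
have gK : g %/ w * w = g by rewrite divnK ?dvdn_gcdr.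
have bK : t b %/ g * g = t b by rewrite divnK ?dvdn_gcdl.
have cK : t c %/ g * g = t c by rewrite divnK ?dvdn_gcdr.
have t_le x : 0 < x -> t x <= x by move=> x_gt0; rewrite dvdn_leq ?free_part_dvd.
have c_ge0 := t_le c c_gt0; have b_ge0 := t_le b b_gt0.
set u := t b %/ g in bK *; set v := t c %/ g in cK *; set h := g %/ w in gK *.
have le1 : (j * h) ^ 2 * (u * v * w) <= j ^ 2 * (b * c).
  apply: leq_trans (_ : j ^ 2 * (t b * t c) <= _); last by rewrite leq_mul2l leq_mul ?orbT.
  rewrite -bK -cK -gK.
  have -> : u * (h * w) * (v * (h * w)) = h ^ 2 * (u * v * w) * w by lia.
  by rewrite expnMn -mulnA leq_mul2l leq_pmulr ?orbT.
set f3 := sum_num c d * _.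
have le2 : f3 * c <= 2 * n * (a * b).
  have le : sum_num c d * c <= 2 * (n * sum_den a b).
    apply: leq_trans (sum_numM_le c_gt0 cd) _.
    rewrite leq_mul2l dvdn_leq ?muln_gt0 ?n_gt0 ?sum_den_gt0//.
    exact: sum_den_dvdl m_gt0 n_gt0 a_gt0 b_gt0 c_gt0 d_gt0 eq4.
  rewrite /f3 -(sum_denK a b); have := leq_mul le (leqnn (gcd_add_mul a b)); lia.
have le3 : (j * h) ^ 2 * (u * v * w) * f3 <= 2 * n * a * (j * b) ^ 2.
  rewrite -(leq_pmul2r c_gt0); have := leq_mul le1 le2; lia.
have yK : m * a - n + n = m * a by rewrite subnK// ltnW// (four_eq_lt m_gt0 n_gt0 a_gt0 b_gt0 c_gt0 d_gt0 eq4).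
set y := m * a - n in y_ge yK.
have yb : y * b <= 3 * (n * a) by exact: four_eq_second_le eq4.
(* m j = y + (n mod m) < y + m, and m <= y. *)
have jm : m * j <= 2 * y.
  rewrite /j mulnBr -yK; move: (divn_eq n m) (ltn_pmod n m_gt0).
  move: (n %/ m) (n %% m) => q0 r0 nE r0_lt; clear -nE r0_lt y_ge; lia.
have am : m * a <= 4 * n by exact: four_eq_first_le eq4.
have le4 : j * b * m <= 6 * (n * a).
  apply: leq_trans (_ : 2 * y * b <= _); last by clear -yb; lia.
  by rewrite mulnAC leq_mul2r [j * m]mulnC jm orbT.
apply: leq_trans (_ : 2 * n * a * (j * b) ^ 2 * m ^ 5 <= _); first by rewrite leq_mul2r le3 orbT.
have -> : 2 * n * a * (j * b) ^ 2 * m ^ 5 = 2 * n * (j * b * m) ^ 2 * (m * a) * m ^ 2 by clear -yb; lia.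
apply: leq_trans (_ : 2 * n * (6 * (n * a)) ^ 2 * (m * a) * m ^ 2 <= _).
  by rewrite leq_mul2r leq_mul2r leq_mul2l leq_sqr le4 !orbT.
have -> : 2 * n * (6 * (n * a)) ^ 2 * (m * a) * m ^ 2 = 72 * n ^ 3 * (m * a) ^ 3 by clear -yb; lia.
apply: leq_trans (_ : 72 * n ^ 3 * (4 * n) ^ 3 <= _); last by clear -yb; lia.
by rewrite leq_mul2l leq_exp2r// am orbT.
Qed.

(** * Determining parameters for four fractions *)

Section FourFractions.
Variables (S : eqType) (M D B : nat).
Hypothesis tau_le : forall W, 0 < W <= M -> size (divisors W) <= D.
Hypotheses (B_gt1 : 1 < B) (BM : B ^ 12 <= M).

Let leM i x : i <= 12 -> x <= B ^ i -> x <= M.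
Proof. by move=> i12 /(leq_pow_trans B_gt1 i12)/leq_trans; apply. Qed.

Let leB1 x : x <= B -> x <= B ^ 1. Proof. by rewrite expn1. Qed.

Variables (P : S -> Prop) (a b c d : S -> nat) (m n : nat).
Hypotheses (m_gt0 : 0 < m) (n_gt0 : 0 < n) (mB : m <= B) (nB : n <= B).
Hypothesis P_gt0 : forall s, P s -> [/\ 0 < a s, 0 < b s, 0 < c s & 0 < d s].
Hypothesis PB : forall s, P s -> [/\ a s <= B, b s <= B, c s <= B & d s <= B].
Hypothesis Peq : forall s, P s -> four_eq m n (a s) (b s) (c s) (d s).
Hypothesis P1 : forall x y z w,
  at_most 1 (fun s => P s /\ [/\ a s = x, b s = y, c s = z & d s = w]).
Local Notation t := (free_part n).
Local Notation g s := (gcdn (t (b s)) (t (c s))).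
Local Notation w s := (gcdn (t (a s)) (g s)).

Let t_le x : 0 < x -> x <= B -> t x <= B.
Proof. by move=> x_gt0; apply: leq_trans; rewrite dvdn_leq ?free_part_dvd. Qed.

Let lt_na s : P s -> n < m * a s.
Proof. by move=> Ps; have [? ? ? ?] := P_gt0 Ps; apply: four_eq_lt (Peq Ps). Qed.

Let j_gt0 s : P s -> 0 < a s - n %/ m.
Proof.
by move=> Ps; rewrite subn_gt0 ltn_divLR// mulnC lt_na.
Qed.

Let g_gt0 s : P s -> 0 < g s.
Proof. by move=> Ps; have [? ? ? ?] := P_gt0 Ps; rewrite gcdn_gt0 free_part_gt0. Qed.

(** The divisor j = a - floor(n/m) of v gives a, and w divides a. Then g = (v / j) w is known,
    gcd(b, c) divides n g, and three fractions of sum (m a - n)/(n a) remain. The shift by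
    floor(n/m) only serves to make the parameter small. *)
Lemma at_most_shift_gcd v :
  at_most (D ^ 5) (fun s => P s /\ (a s - n %/ m) * (g s %/ w s) = v).
Proof.
rewrite (_ : D ^ 5 = D * (D * (D * (D * (D * 1))))); last by lia.
apply: (at_most_dvd tau_le (g := fun s => a s - n %/ m) (W := v)).
  move=> s [Ps <-]; have [a_gt0 b_gt0 c_gt0 d_gt0] := P_gt0 Ps.
  have [aB bB cB dB] := PB Ps; split; first by rewrite dvdn_mulr.
    by rewrite muln_gt0 j_gt0//= divn_gcdr_gt0 ?g_gt0.
  apply: (leM (i := 1 + 1)) => //; apply: leq_mul_pow; apply: leB1.
    by apply: leq_trans aB; apply: leq_subr.
  apply: leq_trans (leq_div _ _) _; apply: leq_trans (t_le b_gt0 bB).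
  by rewrite dvdn_leq ?free_part_gt0 ?dvdn_gcdl.
move=> j; set x := j + n %/ m.
have xE s : P s -> a s - n %/ m = j -> a s = x.
  by move=> Ps jE; rewrite /x -jE subnK//; have := j_gt0 Ps; rewrite subn_gt0 => /ltnW.
apply: (at_most_dvd tau_le (g := fun s => w s) (W := x)).
  move=> s [[Ps _] /(xE s Ps) <-]; have [a_gt0 _ _ _] := P_gt0 Ps.
  have [aB _ _ _] := PB Ps.
  by rewrite (dvdn_trans (dvdn_gcdl _ _)) ?free_part_dvd//; split=> //; apply: leM (leB1 aB).
move=> w0; apply: (at_most_dvd tau_le (g := fun s => gcdn (b s) (c s)) (W := n * (v %/ j * w0))).
  move=> s [[[Ps <-] <-] <-]; have [a_gt0 b_gt0 c_gt0 d_gt0] := P_gt0 Ps.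
  have [aB bB cB dB] := PB Ps.
  rewrite mulKn ?j_gt0// divnK ?dvdn_gcdr// dvdn_gcd_free_part muln_gt0 n_gt0 g_gt0//.
  split=> //; apply: (leM (i := 1 + 1)) => //; apply: leq_mul_pow; apply: leB1 => //.
  by apply: leq_trans (t_le b_gt0 bB); rewrite dvdn_leq ?free_part_gt0 ?dvdn_gcdl.
move=> e; apply: (at_most_three_fractions tau_le (E := b) (a := c) (b := d)
  (R := 1) (p := m * x - n) (q := n * x) (e := e)).
- by move=> s [[[[/P_gt0[]]]]].
- by move=> s [].
- move=> s [[[[Ps _] /(xE s Ps) <-] _] _]; have [? ? ? ?] := P_gt0 Ps.
  by have := four_eq_subl m_gt0 n_gt0 _ _ _ _ (Peq Ps); lia.
- move=> s [[[[Ps _] /(xE s Ps) <-] _] <-]; have [a_gt0 b_gt0 c_gt0 d_gt0] := P_gt0 Ps.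
  have [aB bB cB dB] := PB Ps.
  have gB : gcdn (b s) (c s) <= B ^ 1.
    by apply/leB1/(leq_trans _ bB); rewrite dvdn_leq ?dvdn_gcdl.
  have pB : m * a s - n <= B ^ (1 + 1).
    by apply: leq_trans (leq_subr _ _) (leq_mul_pow (leB1 mB) (leB1 aB)).
  have qB := leq_mul_pow (leB1 nB) (leB1 aB).
  have q1B : (n * a s) ^ 3 * 1 <= B ^ (2 * 3) by rewrite muln1 leq_exp_pow.
  have q2B : (n * a s) ^ 2 * 1 <= B ^ (2 * 2) by rewrite muln1 leq_exp_pow.
  have W1 := leq_mul_pow q1B gB.
  have W2 := leq_mul_pow (leq_mul_pow pB gB) W1.
  split=> //; first by rewrite muln_gt0 n_gt0.
    exact: leM W1.
  by apply: (leM _ (leq_add_pow B_gt1 W2 (leq_pow_trans B_gt1 _ q2B))).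
- move=> y z u; apply: sub_at_most (@P1 x y z u) => s [[[[[Ps _] /(xE s Ps)]]]].
  by [].
Qed.

(** The ratio b/c and R = num(b, c) come first, then the gcd of E = den(b, c) with a. Now m/n = R/E
    + 1/a + 1/d yields E, a and d, and R/E = 1/b + 1/c yields b and c. *)
Lemma at_most_cofactors4 v : at_most (D ^ 7) (fun s => P s /\
  t (b s) %/ g s * (t (c s) %/ g s) * w s = v).
Proof.
rewrite (_ : D ^ 7 = D * (D * (D * (D * (D * (D * (D * 1))))))); last by lia.
have t_div_le s x : 0 < x -> x <= B -> t x %/ g s <= B ^ 1.
  by move=> x_gt0 xB; apply/leB1/(leq_trans (leq_div _ _))/t_le.
have v_bound s : P s -> t (b s) %/ g s * (t (c s) %/ g s) * w s = v -> 0 < v <= B ^ 3.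
  move=> Ps <-; have [a_gt0 b_gt0 c_gt0 d_gt0] := P_gt0 Ps.
  have [aB bB cB dB] := PB Ps; rewrite !muln_gt0 divn_gcdl_gt0 ?free_part_gt0//.
  rewrite divn_gcdr_gt0 ?free_part_gt0//= gcdn_gt0 free_part_gt0//=.
  have wB : w s <= B ^ 1.
    apply: leB1; apply: leq_trans (t_le a_gt0 aB).
    by rewrite dvdn_leq ?free_part_gt0 ?dvdn_gcdl.
  exact: leq_mul_pow (leq_mul_pow (t_div_le s _ b_gt0 bB) (t_div_le s _ c_gt0 cB)) wB.
apply: (at_most_ratio tau_le (a := b) (b := c) (W := n * v)) => [s [Ps vE]|s [Ps <-]|s [Ps <-]|s [Ps _]|u1 u2 R].
- have [a_gt0 b_gt0 c_gt0 d_gt0] := P_gt0 Ps.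
  have /andP[v_gt0 vB] := v_bound s Ps vE; rewrite muln_gt0 n_gt0 v_gt0.
  by split=> //; apply: leM (leq_mul_pow (leB1 nB) vB).
- have [_ b_gt0 _ _] := P_gt0 Ps.
  by apply: dvdn_trans (dvdn_div_gcd_free_part n_gt0 _ b_gt0) _; rewrite !mulnA -!mulnA dvdn_mul// dvdn_mulr.
- have [_ _ c_gt0 _] := P_gt0 Ps; rewrite gcdnC.
  apply: dvdn_trans (dvdn_div_gcd_free_part n_gt0 _ c_gt0) _.
  by rewrite [gcdn (t (c s)) _]gcdnC dvdn_mul// dvdn_mulr// dvdn_mull.
- have [aB bB cB dB] := PB Ps.
  by apply: leM (leq_add_pow B_gt1 (leB1 bB) (leB1 cB)).
pose E s := sum_den (b s) (c s).
have E_gt0 s : P s -> 0 < E s by move=> /P_gt0[*]; rewrite sum_den_gt0.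
apply: (at_most_dvd tau_le (g := fun s => gcdn (E s) (a s)) (W := n ^ 3 * v)).
  move=> s [[Ps vE] _ _ _]; have /andP[v_gt0 vB] := v_bound s Ps vE.
  have [a_gt0 b_gt0 c_gt0 d_gt0] := P_gt0 Ps.
  split; last 2 first.
  - by rewrite muln_gt0 expn_gt0 n_gt0.
  - by apply: leM (leq_mul_pow (leq_exp_pow 3 (leB1 nB)) vB).
  (* E divides G (b/G) (c/G), so its gcd with a divides gcd(G, a) (b/G) (c/G). These three factors
     divide n w, n (t(b)/g) and n (t(c)/g), whose product is n^3 v. *)
  set G := gcdn (b s) (c s).
  have G_gt0 : 0 < G by rewrite gcdn_gt0 b_gt0.
  have bK : b s %/ G * G = b s by rewrite divnK ?dvdn_gcdl.
  have cK : c s %/ G * G = c s by rewrite divnK ?dvdn_gcdr.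
  have E_dvd : E s %| G * (b s %/ G) * (c s %/ G).
    have G_dvd : G %| gcd_add_mul (b s) (c s).
      by rewrite dvdn_gcd dvdn_add ?dvdn_mulr ?dvdn_gcdl ?dvdn_gcdr.
    rewrite -(dvdn_pmul2r G_gt0) [G * _]mulnC bK -mulnA cK -(sum_denK (b s) (c s)).
    by rewrite dvdn_mul.
  have step1 : gcdn (E s) (a s) %| gcdn G (a s) * (b s %/ G) * (c s %/ G).
    apply: dvdn_trans (_ : gcdn (G * (b s %/ G) * (c s %/ G)) (a s) %| _).
      by rewrite dvdn_gcd dvdn_gcdr (dvdn_trans (dvdn_gcdl _ _)).
    apply: dvdn_trans (gcdnM_dvd _ _ _) _; apply: dvdn_mul (dvdn_gcdl _ _).
    by apply: dvdn_trans (gcdnM_dvd _ _ _) _; apply: dvdn_mul (dvdn_gcdl _ _).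
  apply: dvdn_trans step1 _.
  have -> : n ^ 3 * v = n * w s * (n * (t (b s) %/ g s)) * (n * (t (c s) %/ g s)).
    by rewrite -vE; lia.
  apply: dvdn_mul; last first.
    rewrite /G gcdnC [g s]gcdnC; exact: dvdn_div_gcd_free_part.
  apply: dvdn_mul; last exact: dvdn_div_gcd_free_part.
  rewrite gcdnC muln_gcdr dvdn_gcd (dvdn_trans (dvdn_gcdl _ _)) ?dvdn_free_part//=.
  by rewrite (dvdn_trans (dvdn_gcdr _ _)) ?dvdn_gcd_free_part.
move=> e; apply: (at_most_three_fractions tau_le (E := E) (a := a) (b := d)
  (R := R) (p := m) (q := n) (e := e)).
- by move=> s [[[Ps _] _ _ _] _]; have [? ? ? ?] := P_gt0 Ps; rewrite E_gt0.
- by move=> s [].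
- move=> s [[[Ps _] _ _ <-] _]; have [? ? ? ?] := P_gt0 Ps.
  by rewrite /E -(four_eq_sum2 m_gt0 n_gt0 _ _ _ _ (Peq Ps))// !mulnA.
- move=> s [[[Ps _] _ _ <-] <-]; have [a_gt0 b_gt0 c_gt0 d_gt0] := P_gt0 Ps.
  have [aB bB cB dB] := PB Ps.
  have gB : gcdn (E s) (a s) <= B ^ 1.
    by apply/leB1/(leq_trans _ aB); rewrite dvdn_leq ?dvdn_gcdr.
  have RB : sum_num (b s) (c s) <= B ^ 2.
    by apply: leq_trans (sum_num_leD _ _) (leq_add_pow B_gt1 (leB1 bB) (leB1 cB)).
  have n1B := leB1 nB.
  have W1 := leq_mul_pow (leq_mul_pow (leq_exp_pow 3 n1B) RB) gB.
  have W2 := leq_mul_pow (leq_mul_pow (leB1 mB) gB) W1.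
  have W3 := leq_mul_pow (leq_exp_pow 2 n1B) RB.
  split=> //; first by rewrite sum_num_gt0.
    exact: leM W1.
  by apply: (leM _ (leq_add_pow B_gt1 W2 (leq_pow_trans B_gt1 _ W3))).
move=> x y z; apply: (at_most_two_fractions tau_le (a := b) (b := c) (R := R) (E := x)).
  move=> s [[[[Ps _] _ _ <-] _] <- _ _]; have [a_gt0 b_gt0 c_gt0 d_gt0] := P_gt0 Ps.
  have [aB bB cB dB] := PB Ps.
  split=> //; first by rewrite -mulnA sum_num_den.
    exact: E_gt0.
  apply: leM (leq_exp_pow 2 (leq_trans (sum_den_leM _ _) (leq_mul_pow (leB1 bB) (leB1 cB)))).
  by [].
by move=> y' z'; apply: sub_at_most (@P1 y y' z' z) => s [[[[[Ps _] _ _ _] _] _ -> ->] -> ->].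
Qed.

(** The ratio k = n den(c, d) / den(a, b) divides n^2. From k and v, [four_eq_prod] gives the value
    of (m a - n)(m b - n); its divisors give a and b, and 1/c + 1/d is then known. *)
Lemma at_most_num_gcd v :
  at_most (D ^ 3) (fun s => P s /\ sum_num (c s) (d s) * gcd_add_mul (a s) (b s) = v).
Proof.
rewrite (_ : D ^ 3 = D * (D * (D * 1))); last by lia.
pose k s := n * sum_den (c s) (d s) %/ sum_den (a s) (b s).
have n2B : n ^ 2 <= B ^ 2 by rewrite leq_exp2r.
have k_dvd s : P s -> k s %| n ^ 2.
  move=> Ps; have [a_gt0 b_gt0 c_gt0 d_gt0] := P_gt0 Ps.
  apply: dvdn_quotient_sqr; first by rewrite sum_den_gt0.
    exact: sum_den_dvdr (Peq Ps).
  exact: sum_den_dvdl (Peq Ps).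
apply: (at_most_dvd tau_le (g := k) (W := n ^ 2)) => [s [Ps _]|k0].
  by rewrite k_dvd// expn_gt0 n_gt0; split=> //; apply: leM n2B.
have prod_eq s : (P s /\ sum_num (c s) (d s) * gcd_add_mul (a s) (b s) = v) /\ k s = k0 ->
    k0 * ((m * a s - n) * (m * b s - n)) = n ^ 2 * (k0 + m * v).
  move=> [[Ps <-] <-]; have [a_gt0 b_gt0 c_gt0 d_gt0] := P_gt0 Ps.
  exact: four_eq_prod (Peq Ps).
apply: (at_most_dvd tau_le (g := fun s => m * a s - n) (W := n ^ 2 * (k0 + m * v))).
  move=> s Qs; rewrite -(prod_eq s Qs); have [[Ps vE] kE] := Qs.
  have [a_gt0 b_gt0 c_gt0 d_gt0] := P_gt0 Ps; have [aB bB cB dB] := PB Ps.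
  have k_gt0 : 0 < k s.
    by apply: dvdn_gt0 (k_dvd s Ps); rewrite expn_gt0 n_gt0.
  have prod_gt0 : 0 < k0 * ((m * a s - n) * (m * b s - n)).
    by rewrite prod_eq// muln_gt0 expn_gt0 n_gt0 addn_gt0 -kE k_gt0.
  split=> //; first by rewrite dvdn_mull// dvdn_mulr.
  have k2B : k0 <= B ^ 2.
    by rewrite -kE; apply: leq_trans n2B; rewrite dvdn_leq ?expn_gt0 ?n_gt0 ?k_dvd.
  have maB : m * a s - n <= B ^ (1 + 1).
    by apply: leq_trans (leq_subr _ _) (leq_mul_pow (leB1 mB) (leB1 aB)).
  have mbB : m * b s - n <= B ^ (1 + 1).
    by apply: leq_trans (leq_subr _ _) (leq_mul_pow (leB1 mB) (leB1 bB)).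
  by apply: leM (leq_mul_pow k2B (leq_mul_pow maB mbB)).
move=> y; pose a0 := (y + n) %/ m.
pose b0 := (n ^ 2 * (k0 + m * v) %/ (k0 * y) + n) %/ m.
have abE s : ((P s /\ sum_num (c s) (d s) * gcd_add_mul (a s) (b s) = v) /\ k s = k0) /\
    m * a s - n = y -> a s = a0 /\ b s = b0.
  move=> [Qs yE]; rewrite /a0 /b0 -yE -(prod_eq s Qs); have [[Ps vE] kE] := Qs.
  have [a_gt0 b_gt0 c_gt0 d_gt0] := P_gt0 Ps.
  have na := lt_na Ps; rewrite subnK 1?ltnW// mulKn//; split=> //.
  have k_gt0 : 0 < k s.
    by apply: dvdn_gt0 (k_dvd s Ps); rewrite expn_gt0 n_gt0.
  have prod_gt0 : 0 < k0 * ((m * a s - n) * (m * b s - n)).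
    by rewrite prod_eq// muln_gt0 expn_gt0 n_gt0 addn_gt0 -kE k_gt0.
  rewrite mulnA in prod_gt0 *; rewrite mulKn; last by move: prod_gt0; rewrite muln_gt0 => /andP[].
  rewrite subnK ?mulKn//.
  by move: prod_gt0; rewrite muln_gt0 subn_gt0 => /andP[_ /ltnW].
apply: (at_most_two_fractions tau_le (a := c) (b := d) (R := m * a0 * b0 - n * (a0 + b0))
  (E := n * (a0 * b0))).
  move=> s Qs; have [<- <-] := abE s Qs; have [[[Ps _] _] _] := Qs.
  have [a_gt0 b_gt0 c_gt0 d_gt0] := P_gt0 Ps; have [aB bB cB dB] := PB Ps.
  split=> //.
  - rewrite !mulnBl; suff -> : m * a s * b s * c s * d s =
      n * (a s * b s) * (c s + d s) + n * (a s + b s) * c s * d s by rewrite addnK.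
    by have := Peq Ps; rewrite /four_eq; clear; lia.
  - by rewrite !muln_gt0 n_gt0 a_gt0.
  - by apply: leM (leq_exp_pow 2 (leq_mul_pow (leB1 nB) (leq_mul_pow (leB1 aB) (leB1 bB)))).
move=> z u; apply: sub_at_most (@P1 a0 b0 z u) => s [Qs cE dE].
by have [aE bE] := abE s Qs; have [[[Ps _] _] _] := Qs.
Qed.

End FourFractions.

(** m/n - 1/a - 1/b is a positive integer divided by n a b, hence at least 1/(n a b), and it equals
    1/c + 1/d <= 2/c. *)
Lemma four_eq_third_le m n a b c d : 0 < n -> 0 < a -> a <= b -> b <= c -> c <= d ->
  four_eq m n a b c d -> c <= 2 * (n * (a * b)).
Proof.
move=> n_gt0 a_gt0 ab bc cd eq4.
have b_gt0 := leq_trans a_gt0 ab; have c_gt0 := leq_trans b_gt0 bc.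
have d_gt0 := leq_trans c_gt0 cd.
have eqX : (m * a * b - n * (a + b)) * (c * d) = n * (a * b) * (c + d).
  rewrite mulnBl (_ : m * a * b * (c * d) =
    n * (a * b) * (c + d) + n * (a + b) * (c * d)) ?addnK//.
  by have := eq4; rewrite /four_eq; clear; lia.
have X_gt0 : 0 < m * a * b - n * (a + b).
  have : 0 < n * (a * b) * (c + d) by rewrite !muln_gt0 n_gt0 a_gt0 b_gt0 addn_gt0 c_gt0.
  by rewrite -eqX muln_gt0 => /andP[].
rewrite -(leq_pmul2r d_gt0); apply: leq_trans (leq_pmull _ X_gt0) _; rewrite eqX.
have -> : 2 * (n * (a * b)) * d = n * (a * b) * (d + d) by lia.
by rewrite leq_mul2l leq_add2r cd orbT.
Qed.

Lemma four_eq_fourth_le m n a b c d : 0 < n -> 0 < a -> 0 < b -> 0 < c -> 0 < d ->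
  four_eq m n a b c d -> d <= n * (a * b * c).
Proof.
move=> n_gt0 a_gt0 b_gt0 c_gt0 d_gt0 eq4.
have eqX : (m * (a * b * c) - n * (b * c + a * c + a * b)) * d = n * (a * b * c).
  rewrite mulnBl (_ : m * (a * b * c) * d =
    n * (a * b * c) + n * (b * c + a * c + a * b) * d) ?addnK//.
  by have := eq4; rewrite /four_eq; clear; lia.
have X_gt0 : 0 < m * (a * b * c) - n * (b * c + a * c + a * b).
  have : 0 < n * (a * b * c) by rewrite !muln_gt0 n_gt0 a_gt0 b_gt0.
  by rewrite -eqX muln_gt0 => /andP[].
by rewrite -eqX leq_pmull.
Qed.

(** Successively a <= 4 n, b <= 12 n^2, c <= 96 n^4 and d <= n a b c. *)
Lemma four_eq_bound m n a b c d : 0 < m -> 0 < n ->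
  0 < a -> a <= b -> b <= c -> c <= d ->
  four_eq m n a b c d -> d <= 4608 * n ^ 8.
Proof.
move=> m_gt0 n_gt0 a_gt0 ab bc cd eq4.
have b_gt0 := leq_trans a_gt0 ab; have c_gt0 := leq_trans b_gt0 bc.
have d_gt0 := leq_trans c_gt0 cd.
have a_le : a <= 4 * n.
  by apply: leq_trans (four_eq_first_le a_gt0 ab bc cd eq4); rewrite leq_pmull.
have b_le : b <= 3 * (n * (4 * n)).
  apply: leq_trans (_ : 3 * (n * a) <= _); last by rewrite !leq_mul2l a_le !orbT.
  apply: leq_trans (four_eq_second_le a_gt0 ab bc cd eq4); rewrite leq_pmull// subn_gt0.
  exact: four_eq_lt eq4.
have ab_le := leq_mul a_le b_le.
have c_le : c <= 2 * (n * (4 * n * (3 * (n * (4 * n))))).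
  apply: leq_trans (four_eq_third_le n_gt0 a_gt0 ab bc cd eq4) _.
  by rewrite leq_mul2l leq_mul2l ab_le !orbT.
apply: leq_trans (four_eq_fourth_le n_gt0 a_gt0 b_gt0 c_gt0 d_gt0 eq4) _.
apply: leq_trans (leq_mul (leqnn n) (leq_mul ab_le c_le)) _.
by clear; lia.
Qed.

(** * Counting according to the size of m a - n *)

Section FourFractionsCount.
Variables (S : eqType) (M D B : nat).
Hypothesis tau_le : forall W, 0 < W <= M -> size (divisors W) <= D.
Hypotheses (B_gt1 : 1 < B) (BM : B ^ 12 <= M) (D_gt0 : 0 < D).
Variables (P : S -> Prop) (a b c d : S -> nat) (m n : nat).
Hypotheses (m_gt0 : 0 < m) (n_gt0 : 0 < n) (mB : m <= B) (nB : n <= B).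
Hypothesis P_le : forall s, P s ->
  [/\ 0 < a s, a s <= b s, b s <= c s, c s <= d s & d s <= B].
Hypothesis Peq : forall s, P s -> four_eq m n (a s) (b s) (c s) (d s).
Hypothesis P1 : forall x y z w,
  at_most 1 (fun s => P s /\ [/\ a s = x, b s = y, c s = z & d s = w]).

Let P_gt0 s : P s -> [/\ 0 < a s, 0 < b s, 0 < c s & 0 < d s].
Proof. by case/P_le => *; split; lia. Qed.

Let PB s : P s -> [/\ a s <= B, b s <= B, c s <= B & d s <= B].
Proof. by case/P_le => *; split; lia. Qed.

Let n_lt s : P s -> n < m * a s.
Proof. by move=> Ps; have [? ? ? ?] := P_gt0 Ps; apply: four_eq_lt (Peq Ps). Qed.

Lemma at_most_four_large :
  exists2 Y, Y ^ 4 * m ^ 5 <= 4608 * n ^ 6 &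
    at_most (Y * (3 * D ^ 7)) (fun s => P s /\ m <= m * a s - n).
Proof.
have m5_gt0 : 0 < m ^ 5 by rewrite expn_gt0 m_gt0.
have [Y Y_le Y_max] := exists_root (4608 * n ^ 6) (isT : 0 < 4) m5_gt0.
exists Y => //; pose t := free_part n.
pose g s := gcdn (t (b s)) (t (c s)); pose w s := gcdn (t (a s)) (g s).
pose f1 s := (a s - n %/ m) * (g s %/ w s).
pose f2 s := t (b s) %/ g s * (t (c s) %/ g s) * w s.
pose f3 s := sum_num (c s) (d s) * gcd_add_mul (a s) (b s).
have f_gt0 s : P s -> [/\ 0 < f1 s, 0 < f2 s & 0 < f3 s].
  move=> Ps; have [a_gt0 b_gt0 c_gt0 d_gt0] := P_gt0 Ps.
  have tb_gt0 : 0 < t (b s) by apply: free_part_gt0.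
  have tc_gt0 : 0 < t (c s) by apply: free_part_gt0.
  have g_gt0 : 0 < g s by rewrite gcdn_gt0 tb_gt0.
  split.
  - by rewrite muln_gt0 divn_gcdr_gt0// subn_gt0 ltn_divLR// mulnC n_lt.
  - by rewrite !muln_gt0 divn_gcdl_gt0// divn_gcdr_gt0// gcdn_gt0 g_gt0 orbT.
  - by rewrite muln_gt0 sum_num_gt0// gcd_add_mul_gt0.
have f_le s : P s -> m <= m * a s - n ->
    f1 s ^ 2 * f2 s * f3 s * m ^ 5 <= 4608 * n ^ 6.
  move=> Ps; have [a_gt0 ab bc cd _] := P_le Ps.
  exact: four_fractions_inequality (Peq Ps).
(* The exponents 2, 1, 1 of the parameters add up to 4, whence the fourth root. *)
have small s : P s /\ m <= m * a s - n -> f1 s <= Y \/ (f2 s <= Y \/ f3 s <= Y).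
  move=> [Ps yge]; have [x1 x2 x3] := f_gt0 s Ps; have := f_le s Ps yge.
  move: (f1 s) (f2 s) (f3 s) x1 x2 x3 => x1 x2 x3 gt1 gt2 gt3 x_le.
  case: (leqP x1 Y) => [|lt1]; first by left.
  case: (leqP x2 Y) => [|lt2]; first by right; left.
  case: (leqP x3 Y) => [|lt3]; first by right; right.
  suff /Y_max : Y.+1 ^ 4 * m ^ 5 <= 4608 * n ^ 6 by rewrite ltnn.
  apply: leq_trans x_le; rewrite leq_mul2r.
  rewrite (_ : Y.+1 ^ 4 = Y.+1 ^ 2 * Y.+1 * Y.+1); last by clear; lia.
  by rewrite (leq_mul (leq_mul _ lt2) lt3) ?leq_sqr// orbT.
have fib f k : D ^ k <= D ^ 7 -> (forall s, P s -> 0 < f s) ->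
    (forall v, at_most (D ^ k) (fun s => P s /\ f s = v)) ->
    at_most (Y * D ^ 7) (fun s => P s /\ f s <= Y).
  move=> kle fgt0 fk; apply: (at_most_leq (g := f)) => [s [Ps fY]|v].
    by rewrite fY fgt0.
  by apply: (leq_at_most kle); apply: sub_at_most (fk v) => s [[]].
have -> : Y * (3 * D ^ 7) = Y * D ^ 7 + (Y * D ^ 7 + Y * D ^ 7) by clear; lia.
apply: (at_mostU small).
  apply: sub_at_most (fib f1 5 _ _ _) => [s [[]]| |s /f_gt0[]|v] //.
    by rewrite leq_pexp2l.
  exact (at_most_shift_gcd tau_le B_gt1 BM m_gt0 n_gt0 mB nB P_gt0 PB Peq P1 (v:=v)).
apply: (at_mostU (Q1 := fun s => f2 s <= Y) (Q2 := fun s => f3 s <= Y)).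
- by move=> s [].
- apply: sub_at_most (fib f2 7 _ _ _) => [s [[[]]]| |s /f_gt0[]|v] //.
  exact (at_most_cofactors4 tau_le B_gt1 BM m_gt0 n_gt0 mB nB P_gt0 PB Peq P1 (v:=v)).
- apply: sub_at_most (fib f3 3 _ _ _) => [s [[[]]]| |s /f_gt0[]|v] //.
    by rewrite leq_pexp2l.
  exact (at_most_num_gcd tau_le B_gt1 BM m_gt0 n_gt0 mB nB P_gt0 PB Peq P1 (v:=v)).
Qed.

Lemma at_most_four_small :
  exists2 Y, Y ^ 5 * m ^ 3 <= 2304 * n ^ 6 &
    at_most (Y * (4 * D ^ 5)) (fun s => P s /\ m * a s - n < m).
Proof.
(* A fixed solution is needed to bound the common value of a; without one, Y = 0 works. *)
have [[s0 [Ps0 ys0]]|noP] := pselect (exists s, P s /\ m * a s - n < m); last first.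
  exists 0; first by rewrite exp0n.
  by move=> [//|s G] _ GP; case: noP; exists s; apply: GP; rewrite mem_head.
(* n < m a < n + m leaves a single value for a. *)
have aE s : P s -> m * a s - n < m -> a s = (n %/ m).+1.
  move=> Ps ys; apply/eqP; rewrite eqn_leq ltn_divLR// [a s * m]mulnC n_lt// andbT.
  rewrite -ltnS -(ltn_pmul2l m_gt0) !mulnS.
  have := divn_eq n m; have := ltn_pmod n m_gt0; have := n_lt Ps.
  move: (n %/ m) (n %% m) => q0 r0; clear -ys; lia.
set x := (n %/ m).+1 in aE.
have [a_gt0 ab bc cd dB] := P_le Ps0; have xs0 := aE _ Ps0 ys0.
have mx_le : m * x <= 4 * n.
  by rewrite -xs0; apply: four_eq_first_le (Peq Ps0).
have xB : x <= B by rewrite -xs0; have [] := PB Ps0.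
have x_gt0 : 0 < x by [].
have p_gt0 : 0 < m * x - n by rewrite subn_gt0 -xs0 n_lt.
have [||||||Y Y_le Y_at_most] := @at_most_three S M D B tau_le B_gt1 BM
    (fun s => P s /\ m * a s - n < m) b c d (m * x - n) (n * x) p_gt0 _ _ _ _ _ _ D_gt0.
- by rewrite muln_gt0 n_gt0.
- by apply: leq_trans (leq_subr _ _) _; apply: leq_mul.
- exact: leq_mul.
- by move=> s [/P_le[a_s ab' bc' cd' dB'] _]; split=> //; apply: leq_trans ab'.
- move=> s [Ps ys]; have [? ? ? ?] := P_gt0 Ps.
  by rewrite -(aE s Ps ys) (four_eq_subl m_gt0 n_gt0 _ _ _ _ (Peq Ps)).
- move=> y z u; apply: sub_at_most (@P1 x y z u) => s [[Ps ys] bE cE dE].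
  by split=> //; split=> //; apply: aE.
exists Y => //; apply: leq_trans (leq_mul Y_le (leqnn _)) _.
rewrite (_ : 36 * (n * x) ^ 3 * m ^ 3 = 36 * n ^ 3 * (m * x) ^ 3); last by clear; lia.
apply: leq_trans (_ : 36 * n ^ 3 * (4 * n) ^ 3 <= _); last by clear; lia.
by rewrite leq_mul2l leq_exp2r// mx_le orbT.
Qed.

End FourFractionsCount.

(** * The theorem *)

Section NatBounds.
Local Open Scope nat_scope.

Lemma expnD_le x y k : (x + y) ^ k <= 2 ^ k * (x ^ k + y ^ k).
Proof.
case: k => [|k]; first by rewrite !expn0.
wlog xy : x y / x <= y.
  by case: (leqP x y) => [|/ltnW] xy H; [|rewrite addnC [x ^ _ + _]addnC]; apply: H.
apply: leq_trans (_ : (2 * y) ^ k.+1 <= _); first by rewrite leq_exp2r// mul2n -addnn leq_add2r.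
by rewrite expnMn leq_mul2l leq_addl orbT.
Qed.

(** Fifth and fourth powers bring both hypotheses to a 20th power: Y1^20 m^25 <= K1^5 n^30 and Y2^20
    m^12 <= K2^4 n^24. The powers m^3 and m^8 still missing for Y2 are paid for by m <= 4 n. The
    conclusions encode the 20th powers of the two terms of the minimum. *)
Lemma combine_bounds K1 K2 : exists2 C, 0 < C & forall m n Y1 Y2,
  0 < m -> 0 < n -> m <= 4 * n ->
  Y1 ^ 4 * m ^ 5 <= K1 * n ^ 6 -> Y2 ^ 5 * m ^ 3 <= K2 * n ^ 6 ->
  (Y1 + Y2) ^ 20 * m ^ 15 <= C * n ^ 30 /\ (Y1 + Y2) ^ 20 * m ^ 20 <= C * n ^ 32.
Proof.
have [c c20 c_gt0] : exists2 c, c = 2 ^ 20 & 0 < c by exists (2 ^ 20); rewrite ?expn_gt0.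
(* One constant e = 4^8 serves for both m^3 and m^8. *)
have [e e8 e_ge] : exists2 e, 4 ^ 8 = e & 4 ^ 3 <= e by exists (4 ^ 8); rewrite ?leq_exp2l.
exists (c * (K1 ^ 5 + K2 ^ 4 * e).+1); first by rewrite muln_gt0 c_gt0.
move=> m n Y1 Y2 m_gt0 n_gt0 mn le1 le2.
have {}le1 : Y1 ^ 20 * m ^ 25 <= K1 ^ 5 * n ^ 30.
  by rewrite (expnM Y1 4 5) (expnM m 5 5) (expnM n 6 5) -!expnMn leq_exp2r.
have {}le2 : Y2 ^ 20 * m ^ 12 <= K2 ^ 4 * n ^ 24.
  by rewrite (expnM Y2 5 4) (expnM m 3 4) (expnM n 6 4) -!expnMn leq_exp2r.
have sum_le : (Y1 + Y2) ^ 20 <= c * (Y1 ^ 20 + Y2 ^ 20) by rewrite c20 expnD_le.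
have nexp i j : i <= j -> n ^ i <= n ^ j by move=> ij; rewrite leq_pexp2l.
have mexp i j : i <= j -> m ^ i <= m ^ j by move=> ij; rewrite leq_pexp2l.
have mn3 : m ^ 3 <= e * n ^ 3.
  apply: leq_trans (_ : (4 * n) ^ 3 <= _); first by rewrite leq_exp2r.
  by rewrite expnMn leq_mul2r e_ge orbT.
have mn8 : m ^ 8 <= e * n ^ 8.
  by rewrite -e8 -expnMn leq_exp2r.
have suff_le i j : 0 < n ^ j -> Y1 ^ 20 * m ^ i <= K1 ^ 5 * n ^ j ->
    Y2 ^ 20 * m ^ i <= K2 ^ 4 * e * n ^ j ->
    (Y1 + Y2) ^ 20 * m ^ i <= c * (K1 ^ 5 + K2 ^ 4 * e).+1 * n ^ j.
  move=> nj_gt0 h1 h2; apply: leq_trans (leq_mul sum_le (leqnn _)) _.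
  rewrite -(mulnA c) -(mulnA c _ (n ^ j)) leq_mul2l mulnDl; apply/orP; right.
  apply: leq_trans (leq_add h1 h2) _.
  by rewrite -mulnDl leq_mul2r leqnSn orbT.
split; apply: suff_le; rewrite ?expn_gt0 ?n_gt0//.
- by apply: leq_trans le1; rewrite leq_mul2l mexp// orbT.
- rewrite (expnD m 12 3 : m ^ 15 = _) mulnA.
  apply: leq_trans (leq_mul le2 mn3) _.
  by rewrite mulnACA -expnD leq_mul2l nexp ?orbT.
- apply: leq_trans (_ : K1 ^ 5 * n ^ 30 <= _); last by rewrite leq_mul2l nexp// orbT.
  by apply: leq_trans le1; rewrite leq_mul2l mexp// orbT.
- rewrite (expnD m 12 8 : m ^ 20 = _) mulnA.
  apply: leq_trans (leq_mul le2 mn8) _.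
  by rewrite mulnACA -expnD.
Qed.

End NatBounds.

Lemma egyptian4P (m n : nat) (s : 4.-tuple nat) : (0 < n)%N ->
  egyptian 4 (m%:R / n%:R) s ->
  let a := nth 0%N s 0 in let b := nth 0%N s 1 in
  let c := nth 0%N s 2 in let d := nth 0%N s 3 in
  [/\ (0 < a)%N, (a <= b)%N, (b <= c)%N, (c <= d)%N & four_eq m n a b c d].
Proof.
move=> n_gt0 [s_gt0 s_sorted sumE] a b c d.
have nth_gt0 i : (i < 4)%N -> (0 < nth 0%N s i)%N.
  by move=> i4; apply: (all_nthP 0%N s_gt0); rewrite size_tuple.
have nth_le i : (i.+1 < 4)%N -> (nth 0%N s i <= nth 0%N s i.+1)%N.
  move=> i4; apply: (sorted_leq_nth leq_trans leqnn) => //; rewrite inE size_tuple//.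
  exact: ltnW.
split; rewrite ?nth_gt0 ?nth_le//.
have [a0 b0 c0 d0] : [/\ (a%:R : rat) != 0, (b%:R : rat) != 0, (c%:R : rat) != 0
    & (d%:R : rat) != 0]%R.
  by split; rewrite pnatr_eq0 -lt0n nth_gt0.
have n0 : (n%:R : rat) != 0%R by rewrite pnatr_eq0 -lt0n.
have mE : (m%:R : rat)%R = (n%:R * (a%:R^-1 + b%:R^-1 + c%:R^-1 + d%:R^-1))%R.
  rewrite -[LHS](divfK n0) sumE mulrC; congr (_ * _)%R.
  by rewrite !big_ord_recl big_ord0 !(tnth_nth 0%N) /= addr0 !addrA.
rewrite /four_eq; apply/eqP; rewrite -(eqr_nat rat) !(natrM, natrD) mE; apply/eqP.
by field; rewrite a0 b0 c0 d0.
Qed.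

Lemma egyptian_count_at_most (k m n K : nat) :
  at_most K (egyptian k (m%:R / n%:R)) -> (egyptian_count k m n <= K)%N.
Proof.
move=> egK; apply: egK => [|s]; first exact: fset_uniq.
by move=> s_in; move: (s_in); rewrite in_fset_set ?inE//; apply: finite_egyptian.
Qed.

Section Count.
Local Open Scope nat_scope.

Lemma egyptian4_count_bound : exists2 C, 0 < C & forall m n D, 0 < m -> 0 < n -> 0 < D ->
  (forall W, 0 < W <= (4608 * n ^ 8) ^ 12 -> size (divisors W) <= D) ->
  exists Y, [/\ Y ^ 20 * m ^ 15 <= C * n ^ 30, Y ^ 20 * m ^ 20 <= C * n ^ 32 &
                egyptian_count 4 m n <= Y * (4 * D ^ 7)].
Proof.
have [C C_gt0 C_le] := combine_bounds 4608 2304; exists C => //.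
move=> m n D m_gt0 n_gt0 D_gt0 tau_le; pose P := egyptian 4 (m%:R / n%:R)%R.
(* The inequality m <= 4 n is read off a solution; if there is none, Y = 0 works. *)
have [[s0 Ps0]|noP] := pselect (exists s, P s); last first.
  exists 0; rewrite !exp0n// mul0n !leq0n; split=> //.
  apply: egyptian_count_at_most => -[//|s G] _ GP.
  by case: noP; exists s; apply: GP; rewrite mem_head.
pose a (s : 4.-tuple nat) := nth 0 s 0; pose b (s : 4.-tuple nat) := nth 0 s 1.
pose c (s : 4.-tuple nat) := nth 0 s 2; pose d (s : 4.-tuple nat) := nth 0 s 3.
set B := 4608 * n ^ 8 in tau_le.
have n8 : n <= n ^ 8 by rewrite -{1}(expn1 n) leq_pexp2l.
have nB : 4 * n <= B by rewrite leq_mul.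
have P_le s : P s -> [/\ 0 < a s, a s <= b s, b s <= c s, c s <= d s & d s <= B].
  move=> /(egyptian4P n_gt0)[a_gt0 ab bc cd eq4]; split=> //.
  exact: four_eq_bound eq4.
have P_eq s : P s -> four_eq m n (a s) (b s) (c s) (d s).
  by case/(egyptian4P n_gt0).
have P1 x y z w : at_most 1 (fun s => P s /\ [/\ a s = x, b s = y, c s = z & d s = w]).
  apply: at_most_unique => s s' [_ [<- <- <- <-]] [_ [ae be ce de]].
  apply: val_inj; apply: (@eq_from_nth _ 0); rewrite !size_tuple// => i.
  by case: i => [|[|[|[|]]]].
have mn : m <= 4 * n.
  have [a_gt0 ab bc cd _] := P_le _ Ps0.
  by apply: leq_trans (four_eq_first_le a_gt0 ab bc cd (P_eq _ Ps0)); apply: leq_pmulr.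
have B_gt1 : 1 < B by apply: leq_trans nB; apply: leq_trans (_ : 4 * 1 <= _); rewrite ?leq_mul2l.
have mB := leq_trans mn nB.
have nB' : n <= B by apply: leq_trans nB; rewrite leq_pmull.
have [Y1 Y1_le Y1_at_most] := at_most_four_large tau_le B_gt1 (leqnn _) D_gt0
  m_gt0 n_gt0 mB nB' P_le P_eq P1.
have [Y2 Y2_le Y2_at_most] := at_most_four_small tau_le B_gt1 (leqnn _) D_gt0
  m_gt0 n_gt0 mB nB' P_le P_eq P1.
have [le15 le20] := C_le m n Y1 Y2 m_gt0 n_gt0 mn Y1_le Y2_le.
exists (Y1 + Y2); split=> //; apply: egyptian_count_at_most.
apply: (@leq_at_most _ (Y1 * (3 * D ^ 7) + Y2 * (4 * D ^ 5))).
  rewrite mulnDl; apply: leq_add; rewrite leq_mul2l; apply/orP; right.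
    by rewrite leq_mul2r orbT.
  by rewrite leq_mul2l leq_pexp2l.
apply: at_mostU Y1_at_most Y2_at_most => s _.
by case: (leqP m (m * a s - n)) => ?; [left|right].
Qed.

End Count.

Local Open Scope ring_scope.

(** * Passing to real exponents *)

Section Powers.
Variable R : realType.

Lemma powR_exp (x r : R) k : (x `^ r) ^+ k = x `^ (r * k%:R).
Proof. by rewrite -powR_mulrn ?powR_ge0// -powRrM. Qed.

Lemma root_bound (Y C m n i j k : nat) (r s : R) : (0 < k)%N -> (0 < m)%N ->
  r * k%:R = i%:R -> s * k%:R = j%:R ->
  (Y ^ k * m ^ i <= C * n ^ j)%N ->
  Y%:R <= C%:R `^ k%:R^-1 * (n%:R `^ s / m%:R `^ r) :> R.
Proof.
move=> k_gt0 m_gt0 ri sj; rewrite -(ler_nat R) !natrM !natrX => le_nat.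
have k0 : k%:R != 0 :> R by rewrite pnatr_eq0 -lt0n.
rewrite -(ler_pXn2r k_gt0) ?nnegrE ?mulr_ge0 ?divr_ge0 ?powR_ge0//.
rewrite !exprMn exprVn !powR_exp mulVf// ri sj powRr1// !powR_mulrn//.
by rewrite mulrA ler_pdivlMr// exprn_gt0// ltr0n.
Qed.

End Powers.

Theorem theorem1 (R : realType) (eps : R) (heps : 0 < eps) :
  exists C : R, 0 < C /\
    forall m n : nat, (0 < m)%N -> (0 < n)%N ->
      (egyptian_count 4 m n)%:R <= C * n%:R `^ eps *
        Num.min (n%:R `^ (3 / 2) / m%:R `^ (3 / 4)) (n%:R `^ (8 / 5) / m%:R).
Proof.
have [e1 e2] : 3 / 4 * 20%:R = 15%:R :> R /\ 3 / 2 * 20%:R = 30%:R :> R by split; lra.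
have [e3 e4] : 1 * 20%:R = 20%:R :> R /\ 8 / 5 * 20%:R = 32%:R :> R by split; lra.
have [C1 C1_gt0 count_le] := egyptian4_count_bound.
(* Here 672 = 7 * 96 and 96 = 8 * 12: the numbers whose divisors get enumerated are at most a
   constant times n^96, so D is at most a constant times n^(96/k), and D enters the count to the
   seventh power. *)
pose k := (Num.truncn (672 / eps)).+1.
have k_eps : 672 <= eps * k%:R.
  by rewrite mulrC -ler_pdivrMr// ltW// truncnS_gt.
have k_gt0 : (0 < k)%N by [].
have [C0 C0_gt0 tau_le] := size_divisors_exp_bound k_gt0.
pose C2 := (C0 * 4608 ^ 12)%N.
have C2_gt0 : (0 < C2)%N by rewrite muln_gt0 C0_gt0 expn_gt0.
pose A : R := C1%:R `^ 20%:R^-1; pose E : R := C2%:R `^ k%:R^-1.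
have A_gt0 : 0 < A by rewrite powR_gt0 ?ltr0n.
have E_gt0 : 0 < E by rewrite powR_gt0 ?ltr0n.
exists (A * (4 * E ^+ 7)); split; first by rewrite !mulr_gt0// exprn_gt0.
move=> m n m_gt0 n_gt0.
have M_gt0 : (0 < (4608 * n ^ 8) ^ 12)%N by rewrite expn_gt0 muln_gt0 expn_gt0 n_gt0.
have [D D_le D_max] := exists_root (C0 * (4608 * n ^ 8) ^ 12) k_gt0 (isT : (0 < 1)%N).
have D_gt0 : (0 < D)%N by apply: D_max; rewrite exp1n mul1n muln_gt0 C0_gt0.
have tauD W : (0 < W <= (4608 * n ^ 8) ^ 12)%N -> (size (divisors W) <= D)%N.
  move=> /andP[W_gt0 W_le]; apply: D_max; rewrite muln1.
  by apply: leq_trans (tau_le W W_gt0) _; rewrite leq_mul2l W_le orbT.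
have [Y [Y15 Y20 Y_count]] := count_le m n D m_gt0 n_gt0 D_gt0 tauD.
(* Taking 1 for m and 0 for its exponent reduces [root_bound] to a plain k-th root. *)
have DE : D%:R <= E * n%:R `^ (96 / k%:R) :> R.
  have := @root_bound R D C2 1 n 0 96 k 0 (96 / k%:R) k_gt0 isT.
  rewrite powR1 divr1; apply; first by rewrite mul0r.
    by rewrite divfK// pnatr_eq0.
  rewrite muln1; apply: leq_trans (leq_trans _ D_le) _; first by rewrite muln1.
  by rewrite expnMn -expnM /C2 mulnA.
have n1 : 1 <= n%:R :> R by rewrite ler1n.
have D7 : D%:R ^+ 7 <= E ^+ 7 * n%:R `^ eps :> R.
  apply: le_trans (_ : (E * n%:R `^ (96 / k%:R)) ^+ 7 <= _).
    by rewrite ler_pXn2r// nnegrE// mulr_ge0 ?powR_ge0// ltW.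
  rewrite exprMn [(n%:R `^ _) ^+ 7]powR_exp ler_pM2l ?exprn_gt0//.
  by apply: (ler_powR n1); rewrite mulrAC -natrM ler_pdivrMr// ltr0n.
have min_ge : Y%:R <= A * Num.min (n%:R `^ (3 / 2) / m%:R `^ (3 / 4)) (n%:R `^ (8 / 5) / m%:R) :> R.
  rewrite minr_pMr ?(ltW A_gt0)// le_min; apply/andP; split.
    exact: (root_bound (isT : (0 < 20)%N) m_gt0 e1 e2 Y15).
  rewrite -(powRr1 (ler0n R m)).
  exact: (root_bound (isT : (0 < 20)%N) m_gt0 e3 e4 Y20).
apply: le_trans (_ : Y%:R * (4 * D%:R ^+ 7) <= _).
  by rewrite -natrX -!natrM ler_nat.
set F := Num.min _ _ in min_ge *.
rewrite (_ : A * (4 * E ^+ 7) * n%:R `^ eps * F = A * F * (4 * (E ^+ 7 * n%:R `^ eps))).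
  by rewrite ler_pM// ?mulr_ge0 ?exprn_ge0// ler_pM2l// ltr0n.
ring.
Qed.
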